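(* Let $G=(V,E)$ be a finite planar graph with $E\neq\varnothing$ and a fixed embedding in the sphere, let $G^\dagger$ be its dual graph, let $p\in(0,1)$, let $q\ge1$ be an integer, and let $p^*\in(0,1)$ be determined by $\frac{p^*}{1-p^*}=\frac{q(1-p)}{p}$. Let $P_{\rm HB}$ be the transition matrix of the heat-bath dynamics for the random-cluster model on $G$ with parameters $p$ and $q$, and let $P^\dagger_{\rm HB}$ be the transition matrix of the heat-bath dynamics for the dual model, i.e. the random-cluster model on $G^\dagger$ with parameters $p^*$ and $q$. Then $$\lambda(P_{\rm HB})\;=\;\lambda(P^\dagger_{\rm HB}).$$
   Context: The random-cluster (RC) model on a finite graph $G=(V,E)$ with parameters $p,q$ has state space $\{A: A\subseteq E\}$ and probability measure $\mu(A)=\frac{1}{Z}\left(\frac{p}{1-p}\right)^{|A|}q^{c(A)}$, where $c(A)$ is the number of connected components of $(V,A)$ (isolated vertices count) and $Z$ is the normalizing constant. (Lazy) heat-bath dynamics: for $A\ne B$, $$P_{\rm HB}(A,B)=\frac{1}{2|E|}\sum_{e\in E}\frac{\mu(B)}{\mu(A\cup\{e\})+\mu(A\setminus\{e\})}\,\mathbf 1(A\ominus B\subseteq\{e\}),$$ where $\ominus$ is symmetric difference, and $P_{\rm HB}(A,A)$ is chosen so that $P_{\rm HB}$ is stochastic. Dual graph: a planar graph is one that can be embedded in the sphere $S^2$ so that edges intersect only at common endvertices. Given a fixed embedding of $G$, the dual graph $G^\dagger=(V^\dagger,E^\dagger)$ has one vertex in each face and, for each edge $e\in E$, exactly one dual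 edge $e_\dagger$ crossing $e$ and joining the vertices of the faces on the two sides of $e$ (so $|E^\dagger|=|E|$, and $G^\dagger$ may have loops and parallel edges). The random-cluster model on $G^\dagger$ with parameters $p^*$ and $q$ has state space $\{A: A\subseteq E^\dagger\}$ and probability measure $\mu^\dagger(A)=\frac{1}{Z^\dagger}\left(\frac{p^*}{1-p^*}\right)^{|A|}q^{c^\dagger(A)}$, where $c^\dagger(A)$ is the number of connected components of $(V^\dagger,A)$ (isolated vertices count) and $Z^\dagger$ is the normalizing constant. Its (lazy) heat-bath dynamics has, for $A,B\subseteq E^\dagger$ with $A\ne B$, the transition probabilities $$P^\dagger_{\rm HB}(A,B)=\frac{1}{2|E^\dagger|}\sum_{f\in E^\dagger}\frac{\mu^\dagger(B)}{\mu^\dagger(A\cup\{f\})+\mu^\dagger(A\setminus\{f\})}\,\mathbf 1(A\ominus B\subseteq\{f\}),$$ and $P^\dagger_{\rm HB}(A,A)$ is chosen so that $P^\dagger_{\rm HB}$ is stochastic. The spectral gap of a transition matrix $P$ is $\lambda(P)=1-\max\{|\xi|:\xi\text{ is an eigenvalue of }P,\ \xi\ne1\}$. *)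

(* Defs.v *)
(* MathComp / MathComp-Analysis *)
From mathcomp Require Import all_boot all_order all_algebra.
From mathcomp Require Import complex.
From mathcomp Require Import all_classical all_reals all_analysis.
Import Order.TTheory GRing.Theory Num.Theory.
Import numFieldNormedType.Exports.

Set Implicit Arguments.
Unset Strict Implicit.
Unset Printing Implicit Defensive.

Local Open Scope ring_scope.

(* Finite graphs; loops and parallel edges are allowed, since the dual of a
   plane graph may have them. The order of the two ends of an edge is
   immaterial. *)
Record graph := Graph {
  vertex : finType;
  edge : finType;
  ends : edge -> vertex * vertex
}.

Section RandomCluster.
Variables (R : realType) (G : graph).
Implicit Types (p q : R) (A B C : {set edge G}).

Definition adjacent_in A : rel (vertex G) := fun x y =>
  [exists e in A, (ends e == (x, y)) || (ends e == (y, x))].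

Definition ncomponents A : nat := n_comp (adjacent_in A) (vertex G).

Definition rc_weight p q A : R := (p / (1 - p)) ^+ #|A| * q ^+ ncomponents A.

Definition rc_Z p q : R := \sum_(A : {set edge G}) rc_weight p q A.

Definition rc_measure p q A : R := rc_weight p q A / rc_Z p q.

Definition sym_diff A B : {set edge G} := (A :\: B) :|: (B :\: A).

(* The formula for the transition probabilities, valid for A != B only. *)
Definition heat_bath_offdiag p q A B : R :=
  1 / (2 * #|edge G|%:R) *
  \sum_(e : edge G)
     rc_measure p q B / (rc_measure p q (e |: A) + rc_measure p q (A :\ e))
     * (sym_diff A B \subset [set e])%:R.

Definition heat_bath p q A B : R :=
  if A == B then 1 - \sum_(C | C != A) heat_bath_offdiag p q A C
  else heat_bath_offdiag p q A B.

Definition heat_bath_mx p q : 'M[R]_#|{set edge G}| :=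
  \matrix_(i, j) heat_bath p q (enum_val i) (enum_val j).

End RandomCluster.

Local Open Scope classical_set_scope.

(* Eigenvalues are taken over the complex numbers. The set of moduli is finite;
   when it is nonempty the supremum is a maximum (otherwise sup set0 = 0). *)
Definition spectral_gap (R : realType) (n : nat) (P : 'M[R]_n) : R :=
  1 - sup [set complex.Re `|xi| | xi in
             [set xi : R[i] | eigenvalue (map_mx (real_complex R) P) xi
                              /\ xi != 1]].

Definition sphere2 (R : realType) : set 'rV[R]_3 :=
  [set x | \sum_(i < 3) x 0 i ^+ 2 = 1].

(* Topological embeddings in the sphere: each edge is drawn as a continuous
   curve parametrized by [0, 1], without self-intersections except that the two
   endpoints of a loop coincide, and edges meet only at common endvertices. *)
Record sphere_embedding (R : realType) (G : graph) := SphereEmbedding {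
  vpoint : vertex G -> 'rV[R]_3;
  ecurve : edge G -> R -> 'rV[R]_3;
  vpoint_sphere : forall v, sphere2 (vpoint v);
  vpoint_inj : injective vpoint;
  ecurve_sphere : forall e (t : R), `[0, 1] t -> sphere2 (ecurve e t);
  ecurve_continuous : forall e, {within `[0, 1], continuous (ecurve e)};
  ecurve_start : forall e, ecurve e 0 = vpoint (ends e).1;
  ecurve_end : forall e, ecurve e 1 = vpoint (ends e).2;
  ecurve_vpoint : forall e (t : R) v, `]0, 1[ t -> ecurve e t <> vpoint v;
  ecurve_inj : forall e e' (t t' : R), `]0, 1[ t -> `]0, 1[ t' ->
    ecurve e t = ecurve e' t' -> e = e' /\ t = t'
}.

Section Dual.
Variables (R : realType) (G : graph) (Gamma : sphere_embedding R G).

Definition drawing : set 'rV[R]_3 :=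
  range (vpoint Gamma) `|` \bigcup_e (ecurve Gamma e @` `[0, 1]).

Definition face_of (x : 'rV[R]_3) : set 'rV[R]_3 :=
  connected_component (@sphere2 R `\` drawing) x.

Definition is_face (F : set 'rV[R]_3) : Prop :=
  exists2 x, (@sphere2 R `\` drawing) x & F = face_of x.

(* The faces on the two sides of e are those having an interior point of the
   curve e on their boundary; there is only one when both sides coincide. *)
Definition on_side (F : set 'rV[R]_3) (e : edge G) : Prop :=
  exists2 t : R, `]0, 1[ t & closure F (ecurve Gamma e t).

(* The graph H, with one vertex dual_point v placed in each face, and with the
   edges dagger e, is the dual of G for the embedding Gamma. In dagger_ends the
   two ends of dagger e are equal iff a single face lies on both sides of e. *)
Record dual_graph (H : graph) := DualGraph {
  dual_point : vertex H -> 'rV[R]_3;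
  dagger : edge G -> edge H;
  dual_point_face : forall v, (@sphere2 R `\` drawing) (dual_point v);
  dual_point_unique : forall F, is_face F -> exists! v, F (dual_point v);
  dagger_bij : bijective dagger;
  dagger_ends : forall e v,
    (v = (ends (dagger e)).1 \/ v = (ends (dagger e)).2) <->
    on_side (face_of (dual_point v)) e
}.

End Dual.

(* Main.v *)
Require Import Defs.
From mathcomp Require Import all_boot all_order all_algebra.
From mathcomp Require Import complex ring lra zify.
From mathcomp Require Import all_classical all_reals all_analysis.
Import Order.TTheory GRing.Theory Num.Theory.
Import numFieldNormedType.Exports.

Set Implicit Arguments.
Unset Strict Implicit.
Unset Printing Implicit Defensive.

Local Open Scope ring_scope.
Local Open Scope classical_set_scope.

(** Let dual A be the set of the dual edges of the edges outside A, and c the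
    number of components. The theorem rests on the relation of Euler

      c (dual A) + |V| = |A| + c (A) + 1        (ncomponents_dual).

    Because pstar / (1 - pstar) = q (1 - p) / p, it makes the weight of dual A a
    constant multiple of the weight of A. So the bijection A |-> dual A carries
    one random-cluster measure to the other; since it exchanges the insertion
    and the deletion of an edge, it also carries one heat-bath matrix to the
    other, and the two matrices have the same eigenvalues.

    The relation is proved by adding the edges of A one by one. A new edge e adds
    one to |A| + c (A) if A already joins its ends and nothing otherwise; it adds
    one to c (dual A) if its dual edge is a bridge of dual A and nothing
    otherwise. A count (cycle_rank_unique) reduces the relation to two facts:
    if A joins the ends of e, then dual (A + e) does not join the faces on the
    two sides of e (joined_dual_unjoined), because a cycle separates the two
    sides of each of its edges; and the dual of a forest is connected
    (forest_dual_connected), because a forest does not separate the sphere.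

    The edges being arbitrary continuous curves, both facts have the depth of
    the Jordan curve theorem. They are proved with continuous arguments of
    nonvanishing complex functions. For points x, y of the sphere consider, in
    stereographic coordinates, the chord z |-> (z - x) conj (z - y). By lifting
    of homotopies it has a continuous argument off any curve from x to y
    (chord_arg_curve), but it has none on the sphere without x and y
    (no_chord_arg). A cycle through e consists of two arcs between two points x
    and y of e. If it did not separate the sides of e, arguments of the chord
    off each of the two arcs would differ by a constant, and would combine to an
    argument on the sphere without x and y.

    For a forest, every nonvanishing function has a continuous argument on its
    drawing (forest_args_lift), and a compact set with this property does not
    separate the sphere (not_separated): otherwise one could extend a map of
    degree one from a large circle to a map from the plane to the circle. *)

(** * Arguments of nonzero complex numbers *)

Section Argument.
Variable R : realType.
Implicit Types (a b c d r t u : R).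

(** The complex number a + i b is a positive multiple of e^(i t). *)
Definition has_arg a b t := exists2 r, 0 < r & a = r * cos t /\ b = r * sin t.

Lemma has_argM a b t c d u : has_arg a b t -> has_arg c d u ->
  has_arg (a * c - b * d) (a * d + b * c) (t + u).
Proof.
move=> [r r0 [-> ->]] [s s0 [-> ->]]; exists (r * s); first exact: mulr_gt0.
by rewrite cosD sinD; split; ring.
Qed.

Lemma has_arg_conj a b t : has_arg a b t -> has_arg a (- b) (- t).
Proof.
by move=> [r r0 [-> ->]]; exists r => //; rewrite cosN sinN mulrN.
Qed.

Lemma has_argZ r a b t : 0 < r -> has_arg a b t -> has_arg (r * a) (r * b) t.
Proof.
by move=> r0 [s s0 [-> ->]]; exists (r * s); rewrite ?mulr_gt0// !mulrA.
Qed.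

Lemma has_arg_pos a : 0 < a -> has_arg a 0 0.
Proof. by move=> a0; exists a; rewrite // cos0 sin0 mulr1 mulr0. Qed.

Lemma has_arg_uniq a b t u : has_arg a b t -> has_arg a b u -> cos (t - u) = 1.
Proof.
move=> [r r0 [-> ->]] [s s0 [ec es]].
have rs : r ^+ 2 = s ^+ 2.
  have -> : r ^+ 2 = (r * cos t) ^+ 2 + (r * sin t) ^+ 2.
    by rewrite !exprMn -mulrDr cos2Dsin2 mulr1.
  by rewrite ec es !exprMn -mulrDr cos2Dsin2 mulr1.
have {}rs : r = s by apply/eqP; rewrite -(@eqrXn2 _ 2%N)// ?ltW// rs.
rewrite -rs in ec es.
have r1 : r != 0 by rewrite gt_eqF.
rewrite cosB (mulfI r1 ec) (mulfI r1 es) -!expr2; exact: cos2Dsin2.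
Qed.

Lemma has_arg_turn a b t u : has_arg a b t -> cos (u - t) = 1 -> has_arg a b u.
Proof.
move=> [r r0 [-> ->]]; have -> : u = (u - t) + t by rewrite subrK.
rewrite addrK; move: (u - t) => w c1; exists r => //.
have s0 : sin w = 0 by apply: cos1sin0; rewrite c1 normr1.
by rewrite cosD sinD c1 s0 !mul0r !mul1r subr0 add0r.
Qed.

Lemma has_arg_atan a b : 0 < a -> has_arg a b (atan (b / a)).
Proof.
move=> a0; set x := b / a; exists (a * Num.sqrt (1 + x ^+ 2)).
  by rewrite mulr_gt0// sqrtr_gt0 ltr_pwDl// sqr_ge0.
have s0 : Num.sqrt (1 + x ^+ 2) != 0.
  by rewrite gt_eqF// sqrtr_gt0 ltr_pwDl// sqr_ge0.
have -> : sin (atan x) = x * cos (atan x).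
  by rewrite -[X in X * cos _](atanK x) /tan divfK// cos_atan invr_eq0.
rewrite cos_atan; split; first by rewrite mulfK.
by rewrite mulrACA mulfV// mulr1 /x mulrC divfK// gt_eqF.
Qed.

Lemma has_arg_exists a b : a ^+ 2 + b ^+ 2 != 0 -> exists t, has_arg a b t.
Proof.
move=> ab0; have [a0|a0|a0] := ltgtP a 0.
- exists (atan (b / a) + pi).
  have [|r r0 [er es]] := @has_arg_atan (- a) (- b); first by rewrite oppr_gt0.
  rewrite invrN mulrNN in er es.
  exists r => //; rewrite cosDpi sinDpi !mulrN -er -es; split; ring.
- by exists (atan (b / a)); exact: has_arg_atan.
- move: ab0; rewrite a0 expr0n/= add0r sqrf_eq0 => b0.
  have [{}b0|{}b0|e] := ltgtP b 0; last by rewrite e eqxx in b0.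
  + exists (- (pi / 2)); exists (- b); first by rewrite oppr_gt0.
    by rewrite cosN sinN cos_pihalf sin_pihalf mulr0 mulrNN mulr1.
  + by exists (pi / 2); exists b; rewrite // cos_pihalf sin_pihalf mulr0 mulr1.
Qed.

Lemma has_arg_neq0 a b t : has_arg a b t -> a ^+ 2 + b ^+ 2 != 0.
Proof.
move=> [r r0 [-> ->]]; rewrite !exprMn -mulrDr cos2Dsin2 mulr1.
by rewrite expf_neq0// gt_eqF.
Qed.

(** The values of d lie in a translate of the discrete group 2 pi Z, which
    contains no interval. *)
Lemma turns_constant (X : topologicalType) (B : set X) (d : X -> R) (x y : X) :
  connected B -> {within B, continuous d} ->
  (forall z w, B z -> B w -> cos (d z - d w) = 1) ->
  B x -> B y -> d x = d y.
Proof.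
move=> cB cd d1; wlog dxy : x y / d x < d y => [hw Bx By|Bx By].
  by have [/hw|/hw e|//] := ltgtP (d x) (d y); [exact|apply/esym/e].
have /connected_intervalP itv := connected_continuous_connected cB cd.
pose c := Num.min (d y) (d x + pi).
have ltc : d x < c by rewrite lt_min dxy ltrDl pi_gt0.
have [z Bz dz] : (d @` B) c.
  apply: (itv (d x) (d y)); [by exists x|by exists y|].
  by rewrite (ltW ltc) ge_min lexx.
have := d1 z x Bz Bx; rewrite dz -cos0 => /cos_inj.
have cpi : c - d x <= pi by rewrite lerBlDl ge_min lexx orbT.
rewrite !in_itv/= !lexx pi_ge0 cpi subr_ge0 (ltW ltc) => /(_ isT isT)/eqP.
by rewrite subr_eq0 gt_eqF.
Qed.

End Argument.

(** * Lifting arguments along paths and homotopies *)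

Section Continuity.
Variables (R : realType) (X : topologicalType).
Implicit Types f g : X -> R.

(** Stated for displayed functions on an arbitrary domain, these closure
    properties also serve for continuity within a set, where the domain is a
    subspace. *)
Lemma ctsD f g : continuous f -> continuous g -> continuous (fun x => f x + g x).
Proof. by move=> cf cg x; apply: cvgD; [exact: cf|exact: cg]. Qed.

Lemma ctsN f : continuous f -> continuous (fun x => - f x).
Proof. by move=> cf x; apply: cvgN; exact: cf. Qed.

Lemma ctsM f g : continuous f -> continuous g -> continuous (fun x => f x * g x).
Proof. by move=> cf cg x; apply: cvgM; [exact: cf|exact: cg]. Qed.

Lemma ctsX f n : continuous f -> continuous (fun x => f x ^+ n).
Proof.
move=> cf; elim: n => [|n IH]; first by move=> x; exact: cvg_cst.
rewrite (_ : (fun x => _) = (fun x => f x * f x ^+ n)); first exact: ctsM.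
by apply/funext => x; rewrite exprS.
Qed.

Lemma ctsV f : (forall x, f x != 0) -> continuous f ->
  continuous (fun x => (f x)^-1).
Proof. by move=> f0 cf x; apply: cvgV => //; exact: cf. Qed.

Lemma ctsV_on (C : set X) f : (forall x, C x -> f x != 0) -> continuous f ->
  {within C, continuous (fun x => (f x)^-1)}.
Proof.
move=> f0 cf; apply/subspace_continuousP => x Cx.
apply: cvg_within_filter; apply: cvgV; [exact: f0|exact: cf].
Qed.

Lemma cts_cst (Y : topologicalType) (k : Y) : continuous (fun _ : X => k).
Proof. by move=> x; exact: cvg_cst. Qed.

Lemma cts_sum n (f : 'I_n -> X -> R) : (forall i, continuous (f i)) ->
  continuous (fun x => \sum_(i < n) f i x).
Proof.
elim: n f => [|n IH] f cf.
  by under eq_fun do rewrite big_ord0; move=> x; exact: cvg_cst.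
under eq_fun do rewrite big_ord_recl; apply: ctsD; first exact: cf.
by apply: IH => i; exact: cf.
Qed.

Lemma cts_comp (Y Z : topologicalType) (f : X -> Y) (g : Y -> Z) :
  continuous f -> continuous g -> continuous (fun x => g (f x)).
Proof. by move=> cf cg x; apply: continuous_comp; [exact: cf|exact: cg]. Qed.

Lemma cts_id : continuous (fun x : X => x).
Proof. by move=> x; exact: cvg_id. Qed.

Lemma cts_pair (Y Z : topologicalType) (f : X -> Y) (g : X -> Z) :
  continuous f -> continuous g -> continuous (fun x => (f x, g x)).
Proof.
move=> cf cg x.
exact: (@cvg_pair X Y Z (nbhs x) (nbhs (f x)) (nbhs (g x)) _ _ _ f g (cf x) (cg x)).
Qed.

Lemma cts_within_comp (Y Z : topologicalType) (U : set Y) (h : X -> Y) (g : Y -> Z) :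
  continuous h -> {within U, continuous g} -> (forall x, U (h x)) ->
  continuous (fun x => g (h x)).
Proof.
move=> ch /subspace_continuousP cg Uh x A /(cg _ (Uh x)) wA.
apply: (@filterS _ (nbhs x) _ (h @^-1` (fun y => U y -> A (g y)))); last exact: (ch x _ wA).
by move=> y /= yA; exact: yA.
Qed.

End Continuity.

(* Matching on the head symbol spares failing unifications, which are slow. *)
Ltac cts := lazymatch goal with
  | |- continuous (fun x => (@?f x + @?g x)%R) => apply: ctsD; cts
  | |- continuous (fun x => (- @?f x)%R) => apply: ctsN; cts
  | |- continuous (fun x => (@?f x * @?g x)%R) => apply: ctsM; cts
  | |- continuous (fun x => (@?f x ^+ _)%R) => apply: ctsX; cts
  | |- continuous (fun x => ?k) => try exact: cts_cst
  | |- _ => try assumption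
  end.

Section Lifting.
Variable R : realType.

(** Composition with clamp 1 extends a curve on [0, 1] to the whole line. *)
Definition clamp (c s : R) : R := Num.min (Num.max s 0) c.

Lemma cts_clamp c : continuous (clamp c).
Proof.
move=> s; have c0 (k : R) : {for s, continuous (fun=> k : R^o)} by exact: cvg_cst.
apply: (@continuous_min R R^o (fun t => Num.max t 0) (fun=> c)) => //.
apply: (@continuous_max R R^o id (fun=> 0)) => //; exact: cvg_id.
Qed.

Lemma min_add_dist (m u v : R) : 0 <= v ->
  `|Num.min m (u + v) - Num.min m u| <= v.
Proof.
move=> v0; have [h1|h1] := leP m u; have [h2|h2] := leP m (u + v);
  rewrite ler_norml; apply/andP; split; lra.
Qed.

(** Compactness of [0, 1] makes one step length work at all points. *)
Lemma path_nearly_constant (f g : R -> R) :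
  continuous f -> continuous g ->
  (forall s, 0 <= s <= 1 -> f s ^+ 2 + g s ^+ 2 != 0) ->
  exists N : nat, forall s t, 0 <= s <= 1 -> `|s - t| <= N.+1%:R^-1 ->
    0 < f s * f t + g s * g t.
Proof.
move=> cf cg fg0.
have /compact_near_coveringP/near_covering_withinP := @segment_compact R 0 1.
move=> /(_ nat \oo (fun N s => forall t, `|s - t| <= N.+1%:R^-1 ->
    0 < f s * f t + g s * g t) _) []; last first.
  move=> N _ /(_ N (leqnn N)) hN; exists N => s t s01; apply: hN.
  by rewrite /= in_itv.
move=> x /=; rewrite in_itv/= => /fg0 fgx.
pose h (p : R * R) := f p.1 * f p.2 + g p.1 * g p.2.
have ch : continuous h.
  have c1 : continuous (fst : R * R -> R) by move=> p; exact: cvg_fst.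
  have c2 : continuous (snd : R * R -> R) by move=> p; exact: cvg_snd.
  have c3 (k : R -> R) : continuous k -> continuous (fun p : R * R => k p.1).
    by move=> ck; exact: (cts_comp c1 ck).
  have c4 (k : R -> R) : continuous k -> continuous (fun p : R * R => k p.2).
    by move=> ck; exact: (cts_comp c2 ck).
  by rewrite /h; cts; [apply: c3|apply: c4|apply: c3|apply: c4].
have h0 : 0 < h (x, x).
  rewrite /h/= -!expr2 lt_neqAle eq_sym fgx/=.
  by rewrite addr_ge0// sqr_ge0.
have := ch (x, x) _ (lt_nbhsr h0).
case=> /= -[U V] [/= /nbhs_ballP[e1 /= e10 Ue] /nbhs_ballP[e2 /= e20 Ve]] UV.
have [n hn] : exists n : nat, (e2 / 2)^-1 < n%:R.
  by exists (Num.bound (e2 / 2)^-1); rewrite archi_boundP// invr_ge0 divr_ge0// ltW.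
near=> s N => _ t st.
have xs : `|x - s| < e2 / 2.
  by near: s; apply: (nbhsx_ballx x (e2 / 2)); rewrite divr_gt0.
have Ne : N.+1%:R^-1 <= e2 / 2.
  near: N; exists n => // m /= nm; rewrite invf_ple ?posrE ?divr_gt0//.
  by rewrite (le_trans (ltW hn))// ler_nat ltnW.
apply: (UV (s, t)); split => /=.
  by apply: Ue; near: s; exact: nbhsx_ballx.
apply: Ve; rewrite /ball/= -(subrK s x) -addrA (le_lt_trans (ler_normD _ _))//.
by rewrite [e2]splitr ltr_leD// (le_trans st).
Unshelve. all: by end_near. Qed.

(** Along a short step the path stays in a half-plane around its current
    direction, where the argument is an arctangent; the argument of the whole
    path is the sum of the increments. *)
Lemma path_arg (f g : R -> R) a0 :
  continuous f -> continuous g ->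
  (forall s, 0 <= s <= 1 -> f s ^+ 2 + g s ^+ 2 != 0) ->
  has_arg (f 0) (g 0) a0 ->
  exists a : R -> R, [/\ continuous a, a 0 = a0 &
    forall s, 0 <= s <= 1 -> has_arg (f s) (g s) (a s)].
Proof.
move=> cf cg fg0 arg0; have [N hN] := path_nearly_constant cf cg fg0.
pose c (k : nat) := clamp (k%:R / N.+1%:R).
pose re k s := f (c k.+1 s) * f (c k s) + g (c k.+1 s) * g (c k s).
pose im k s := g (c k.+1 s) * f (c k s) - f (c k.+1 s) * g (c k s).
have c01 k s : (k <= N.+1)%N -> 0 <= c k s <= 1.
  move=> kN; rewrite /c /clamp le_min ge_min le_max lexx orbT/=.
  by rewrite divr_ge0//= ler_pdivrMr// mul1r ler_nat kN orbT.
have cS k s : `|c k.+1 s - c k s| <= N.+1%:R^-1.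
  rewrite /c /clamp; set m := Num.max s 0.
  have -> : k.+1%:R / N.+1%:R = k%:R / N.+1%:R + N.+1%:R^-1 :> R.
    by rewrite -addn1 natrD mulrDl mul1r.
  by apply: min_add_dist; rewrite invr_ge0.
have re0 k s : (k < N.+1)%N -> 0 < re k s.
  by move=> kN; apply: hN; [exact: c01|exact: cS].
pose a m s := a0 + \sum_(k < m) atan (im k s / re k s).
have cfc k : continuous (fun s => f (c k s)).
  by apply: cts_comp => //; exact: cts_clamp.
have cgc k : continuous (fun s => g (c k s)).
  by apply: cts_comp => //; exact: cts_clamp.
exists (a N.+1); split.
- apply: ctsD; first exact: cts_cst.
  apply: cts_sum => k; apply: (@cts_comp _ _ _ _ atan); last first.
    by move=> x; exact: continuous_atan.
  apply: ctsM; first by rewrite /im; cts; [exact: cgc|exact: cfc..|exact: cgc].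
  apply: ctsV => [s|]; first by rewrite gt_eqF// re0.
  by rewrite /re; cts; [exact: cfc..|exact: cgc|exact: cgc].
- rewrite /a big1 ?addr0// => k _.
  have c0 m : c m 0 = 0 by rewrite /c /clamp maxxx min_l// divr_ge0.
  by rewrite /im !c0 [g 0 * f 0]mulrC subrr mul0r atan0.
- have arg m s : (m <= N.+1)%N -> 0 <= s -> has_arg (f (c m s)) (g (c m s)) (a m s).
    move=> + s0; elim: m => [_|m IH mN].
      rewrite /a big_ord0 addr0 /c /clamp mul0r.
      by rewrite min_r// le_max lexx orbT.
    rewrite /a big_ord_recr/= addrA.
    have {}IH := IH (ltnW mN).
    have := has_argM IH (has_arg_atan (im m s) (re0 m s mN)).
    set F := f (c m s); set G := g (c m s).
    have n0 : 0 < F ^+ 2 + G ^+ 2.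
      by rewrite lt_neqAle eq_sym (has_arg_neq0 IH) addr_ge0// sqr_ge0.
    rewrite /re /im -/F -/G -/(a m s).
    move=> /(@has_argZ _ (F ^+ 2 + G ^+ 2)^-1); rewrite invr_gt0 => /(_ n0).
    have n1 : F ^+ 2 + G ^+ 2 != 0 by rewrite gt_eqF.
    by move: (f (c m.+1 s)) (g (c m.+1 s)) => F' G'; congr has_arg; field.
  move=> s s01; have := @arg N.+1 s (leqnn _).
  case/andP: s01 => s0 s1; move=> /(_ s0).
  by rewrite /c /clamp divff// max_l// min_l.
Qed.

End Lifting.

Section Homotopy.
Variable R : realType.

Lemma cos_eq1_sub (t u : R) : cos t = 1 -> cos u = 1 -> cos (t - u) = 1.
Proof.
move=> t1 u1; have st : sin t = 0 by apply: cos1sin0; rewrite t1 normr1.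
by rewrite cosB t1 u1 st mul0r addr0 mulr1.
Qed.

Lemma lift_diff (X : topologicalType) (B : set X) (f g a b : X -> R) x y :
  connected B -> {within B, continuous a} -> {within B, continuous b} ->
  (forall z, B z -> has_arg (f z) (g z) (a z)) ->
  (forall z, B z -> has_arg (f z) (g z) (b z)) ->
  B x -> B y -> a x - b x = a y - b y.
Proof.
move=> cB ca cb fa fb.
apply: (@turns_constant _ _ B (fun z => a z - b z)) => //.
  by apply: ctsD => //; exact: ctsN.
by move=> z w Bz Bw; apply: cos_eq1_sub;
  [apply: has_arg_uniq (fa z Bz) (fb z Bz)|apply: has_arg_uniq (fa w Bw) (fb w Bw)].
Qed.

Lemma segment_connected (u v : R) : connected `[u, v].
Proof. by apply/connected_intervalP; exact: interval_is_interval. Qed.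

(** The path lifts of neighbouring points differ by the principal argument of
    a quotient close to 1, because [0, 1] is compact; hence they depend
    continuously on the point. *)
Lemma homotopy_arg (X : topologicalType) (U : set X) (F G : X * R -> R) a0 :
  continuous F -> continuous G ->
  (forall x s, U x -> 0 <= s <= 1 -> F (x, s) ^+ 2 + G (x, s) ^+ 2 != 0) ->
  (forall x, U x -> has_arg (F (x, 0)) (G (x, 0)) a0) ->
  exists a : X -> R, {within U, continuous a} /\
    forall x, U x -> has_arg (F (x, 1)) (G (x, 1)) (a x).
Proof.
move=> cF cG FG0 arg0.
have c2 (x : X) : continuous (fun s : R => (x, s)).
  by apply: cts_pair; [exact: cts_cst|exact: cts_id].
have c1 (s : R) : continuous (fun x : X => (x, s)).
  by apply: cts_pair; [exact: cts_id|exact: cts_cst].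
have cFx x : continuous (fun s => F (x, s)) by exact: cts_comp (c2 x) cF.
have cGx x : continuous (fun s => G (x, s)) by exact: cts_comp (c2 x) cG.
have cFs s : continuous (fun x => F (x, s)) by exact: cts_comp (c1 s) cF.
have cGs s : continuous (fun x => G (x, s)) by exact: cts_comp (c1 s) cG.
have /choice[l lP] x : exists b : R -> R, U x -> [/\ continuous b, b 0 = a0 &
    forall s, 0 <= s <= 1 -> has_arg (F (x, s)) (G (x, s)) (b s)].
  have [Ux|nUx] := pselect (U x); last by exists id.
  have [b bP] := path_arg (cFx x) (cGx x) (fun s => FG0 x s Ux) (arg0 x Ux).
  by exists b.
exists (fun x => l x 1); split; last first.
  by move=> x /lP[_ _]; apply; rewrite ler01 lexx.
apply/subspace_continuousP => x Ux.
pose re y s := F (y, s) * F (x, s) + G (y, s) * G (x, s).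
pose im y s := G (y, s) * F (x, s) - F (y, s) * G (x, s).
have near_re : \forall y \near x, forall s, 0 <= s <= 1 -> 0 < re y s.
  have /compact_near_coveringP/near_covering_withinP := @segment_compact R 0 1.
  move=> /(_ X (nbhs x) (fun y s => 0 < re y s) (nbhs_filter x)) H.
  apply: filterS (H _) => [y h s s01|s].
    by apply: h; rewrite /= in_itv.
  rewrite /= in_itv/= => s01.
    pose h (p : X * R) := F p * F (x, p.2) + G p * G (x, p.2).
    have cs : continuous (snd : X * R -> R) by move=> p; exact: cvg_snd.
    have ch : continuous h.
      rewrite /h; cts.
        exact: (cts_comp cs (cFx x)).
      exact: (cts_comp cs (cGx x)).
    have h0 : 0 < h (x, s).
      by rewrite /h/= -!expr2 lt_neqAle eq_sym FG0//= addr_ge0// sqr_ge0.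
    have [[V W] [/= Vx Ws] VW] := ch (x, s) _ (lt_nbhsr h0).
    exists (W, V) => //= -[t y] [/= Wt Vy] _; exact: (VW (y, t)).
have lE : \forall y \near x, U y -> l y 1 = l x 1 + atan (im y 1 / re y 1).
  apply: filterS near_re => y re0 Uy.
  have [cx x0 xP] := lP _ Ux; have [cy y0 yP] := lP _ Uy.
  pose k : R -> R := clamp 1.
  have k01 s : 0 <= k s <= 1.
    by rewrite /k /clamp le_min ge_min le_max !lexx !orbT ler01.
  have kid s : 0 <= s <= 1 -> k s = s.
    by case/andP => s0 s1; rewrite /k /clamp max_l// min_l.
  pose b s := l x s + atan (im y (k s) / re y (k s)).
  have cb : continuous b.
    rewrite /b; cts; apply: (@cts_comp _ _ _ _ atan); last first.
      by move=> z; exact: continuous_atan.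
    have cFk z : continuous (fun s => F (z, k s)).
      exact: (cts_comp (@cts_clamp R 1) (cFx z)).
    have cGk z : continuous (fun s => G (z, k s)).
      exact: (cts_comp (@cts_clamp R 1) (cGx z)).
    apply: ctsM; first by rewrite /im; cts; [exact: cGk|exact: cFk|exact: cFk|exact: cGk].
    apply: ctsV => [s|]; first by rewrite gt_eqF// re0.
    by rewrite /re; cts; [exact: cFk|exact: cFk|exact: cGk|exact: cGk].
  have bP s : `[0, 1]%classic s -> has_arg (F (y, s)) (G (y, s)) (b s).
    rewrite /= in_itv/= => s01; rewrite /b kid//.
    have := has_argM (xP s s01) (has_arg_atan (im y s) (re0 s s01)).
    set f := F (x, s); set g := G (x, s).
    have n0 : 0 < f ^+ 2 + g ^+ 2.
      by rewrite lt_neqAle eq_sym (has_arg_neq0 (xP s s01)) addr_ge0// sqr_ge0.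
    have n1 : f ^+ 2 + g ^+ 2 != 0 by rewrite gt_eqF.
    move=> /(@has_argZ _ (f ^+ 2 + g ^+ 2)^-1); rewrite invr_gt0 => /(_ n0).
    rewrite {1 2 3 4}/re {1 2}/im -/f -/g.
    by congr has_arg; field.
  have in0 : `[0, 1]%classic (0 : R) by rewrite /= in_itv/= lexx ler01.
  have in1 : `[0, 1]%classic (1 : R) by rewrite /= in_itv/= lexx ler01.
  have yP' s : `[0, 1]%classic s -> has_arg (F (y, s)) (G (y, s)) (l y s).
    by rewrite /= in_itv/=; exact: yP.
  have := lift_diff (@segment_connected 0 1) (continuous_subspaceT cy)
    (continuous_subspaceT cb) yP' bP in0 in1.
  have im0 : im y 0 = 0.
    rewrite /im; have [r _ [-> ->]] := arg0 _ Uy.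
    by have [r' _ [-> ->]] := arg0 _ Ux; ring.
  rewrite /b y0 x0 !kid ?lexx ?ler01// im0 mul0r atan0 addr0 subrr.
  by move/esym/eqP; rewrite subr_eq0 => /eqP.
have re1 : 0 < re x 1.
  by rewrite /re -!expr2 lt_neqAle eq_sym FG0 ?ler01 ?lexx//= addr_ge0// sqr_ge0.
have cl : (fun y => l x 1 + atan (im y 1 / re y 1)) @ x --> l x 1.
  have e : l x 1 = l x 1 + atan (im x 1 / re x 1).
    by rewrite /im [G _ * _]mulrC subrr mul0r atan0 addr0.
  rewrite {2}e; apply: cvgD; first exact: cvg_cst.
  apply: (@continuous_comp _ _ _ (fun y => im y 1 / re y 1) atan); last exact: continuous_atan.
  apply: cvgM; last apply: cvgV; rewrite ?gt_eqF//.
  - have : continuous (im ^~ 1) by rewrite /im; cts. exact.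
  - have : continuous (re ^~ 1) by rewrite /re; cts. exact.
apply: cvg_trans; last exact: (cvg_within_filter _ cl).
apply: near_eq_cvg; rewrite near_withinE.
by apply: filterS lE => y h /h <-.
Qed.

(** The complex function is e^(i t) (u + i v), with u + i v in the right
    half-plane: its argument is t up to an error below pi / 2, so it cannot
    return to its initial value. *)
Lemma circle_no_arg (u v a : R -> R) :
  continuous u -> continuous v -> continuous a -> (forall t, 0 < u t) ->
  u (pi *+ 2) = u 0 -> v (pi *+ 2) = v 0 -> a (pi *+ 2) = a 0 ->
  ~ forall t, has_arg (cos t * u t - sin t * v t) (cos t * v t + sin t * u t) (a t).
Proof.
move=> cu cv ca u0 pu pv pa ha.
pose b t := t + atan (v t / u t).
have cb : continuous b.
  apply: ctsD; first by move=> t; exact: cvg_id.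
  apply: (@cts_comp _ _ _ _ atan); last by move=> z; exact: continuous_atan.
  by apply: ctsM => //; apply: ctsV => // t; rewrite gt_eqF.
have hb t : has_arg (cos t * u t - sin t * v t) (cos t * v t + sin t * u t) (b t).
  apply: has_argM; last exact: has_arg_atan.
  by exists 1; rewrite // !mul1r.
have := lift_diff (@segment_connected 0 (pi *+ 2)) (continuous_subspaceT ca)
    (continuous_subspaceT cb) (fun t _ => ha t) (fun t _ => hb t).
have p0 : 0 < pi *+ 2 :> R by rewrite mulrn_wgt0// pi_gt0.
move=> /(_ 0 (pi *+ 2)); rewrite /= !in_itv/= !lexx (ltW p0) => /(_ isT isT).
by rewrite /b pa pu pv; lra.
Qed.

End Homotopy.

(** * The sphere in stereographic coordinates *)

Section SphereCoordinates.
Variable R : realType.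
Local Notation i0 := (ord0 : 'I_3).
Local Notation i1 := (lift ord0 ord0 : 'I_3).
Local Notation i2 := (lift ord0 (lift ord0 ord0) : 'I_3).
Implicit Types (n x y z : 'rV[R]_3) (O : 'M[R]_3).

Lemma sum_ord3 (V : nmodType) (F : 'I_3 -> V) :
  \sum_i F i = F i0 + F i1 + F i2.
Proof. by rewrite !big_ord_recl big_ord0 addr0 addrA. Qed.

Lemma mul_trmx_rV x y : x *m y^T = (\sum_i x 0 i * y 0 i)%:M.
Proof.
rewrite [LHS]mx11_scalar !mxE; congr _%:M.
by apply: eq_bigr => i _; rewrite mxE.
Qed.

(** The reflection that exchanges the given point and the pole. *)
Lemma rotate_to_pole n : sphere2 n ->
  exists O, O *m O^T = 1%:M /\ n *m O = delta_mx 0 i2.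
Proof.
rewrite /sphere2/= => n1; set e : 'rV[R]_3 := delta_mx 0 i2.
have [->|ne] := eqVneq n e.
  by exists 1%:M; rewrite trmx1 !mulmx1.
pose w := n - e; pose t := 1 - n 0 i2.
have nn : n *m n^T = 1%:M.
  by rewrite mul_trmx_rV; under eq_bigr do rewrite -expr2; rewrite n1.
have ee : e *m e^T = 1%:M.
  by rewrite trmx_delta mul_delta_mx [LHS]mx11_scalar mxE /= mulr1n.
have ne3 : n *m e^T = (n 0 i2)%:M.
  by rewrite trmx_delta -colE [LHS]mx11_scalar !mxE.
have en3 : e *m n^T = (n 0 i2)%:M.
  by rewrite -(trmxK e) -trmx_mul ne3 tr_scalar_mx.
have t0 : t != 0.
  apply: contraNneq ne => /eqP; rewrite subr_eq0 => /eqP n3.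
  move: n1; rewrite sum_ord3 -n3 expr1n => /eqP.
  rewrite -subr_eq0 addrK paddr_eq0 ?sqr_ge0// !sqrf_eq0 => /andP[/eqP a0 /eqP a1].
  apply/eqP/rowP => -[[|[|[|//]]] i3]; rewrite mxE/=.
  - by rewrite -[RHS]a0; congr (n _ _); apply/val_inj.
  - by rewrite -[RHS]a1; congr (n _ _); apply/val_inj.
  - by rewrite [RHS]n3; congr (n _ _); apply/val_inj.
have nw : n *m w^T = t%:M.
  by rewrite linearB/= mulmxBr nn ne3 -[LHS]raddfB.
have ww : w *m w^T = (t *+ 2)%:M.
  rewrite {1}/w mulmxBl nw linearB/= mulmxBr en3 ee -!raddfB/=.
  by congr (_%:M); rewrite /t; ring.
exists (1%:M - t^-1 *: (w^T *m w)); split; last first.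
  rewrite mulmxBr mulmx1 -scalemxAr mulmxA nw mul_scalar_mx scalerA mulVf//.
  by rewrite scale1r /w opprB addrC subrK.
have -> : (1%:M - t^-1 *: (w^T *m w))^T = 1%:M - t^-1 *: (w^T *m w).
  apply/matrixP => i j; rewrite !mxE !big_ord1 !(mxE trmx_key) eq_sym.
  by congr (_ - _ * _); rewrite mulrC.
set W := w^T *m w; have WW : W *m W = (t *+ 2) *: W.
  by rewrite /W mulmxA -(mulmxA _ w w^T) ww scalar_mxC -mulmxA mul_scalar_mx.
have cc : t^-1 *: (t^-1 *: ((t *+ 2) *: W)) = t^-1 *: W + t^-1 *: W.
  by rewrite !scalerA -scalerDl; congr (_ *: _); field.
rewrite mulmxBl !mulmxBr !mul1mx mulmx1 -scalemxAl -scalemxAr WW cc.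
by rewrite opprB addrK subrK.
Qed.

Section Frame.
Variables (O : 'M[R]_3) (hO : O *m O^T = 1%:M).

Definition coord i z : R := (z *m O) 0 i.
Definition of_coord (a b c : R) : 'rV[R]_3 :=
  a *: row i0 O^T + b *: row i1 O^T + c *: row i2 O^T.

Local Notation c0 := (coord i0).
Local Notation c1 := (coord i1).
Local Notation c2 := (coord i2).

Lemma coord_sphere z : sphere2 z <-> c0 z ^+ 2 + c1 z ^+ 2 + c2 z ^+ 2 = 1.
Proof.
have e : \sum_i z 0 i ^+ 2 = c0 z ^+ 2 + c1 z ^+ 2 + c2 z ^+ 2.
  have := mul_trmx_rV (z *m O) (z *m O).
  rewrite trmx_mul mulmxA -(mulmxA z) hO mulmx1 mul_trmx_rV.
  move=> /(congr1 mxtrace); rewrite !mxtrace_scalar !mulr1n [RHS]sum_ord3 => h.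
  by under eq_bigr do rewrite expr2; rewrite h.
by rewrite /sphere2/= e.
Qed.

Lemma coord_inj z y : (forall i, coord i z = coord i y) -> z = y.
Proof.
move=> zy; rewrite -(mulmx1 z) -(mulmx1 y) -hO !mulmxA; congr (_ *m _).
by apply/rowP => i; exact: zy.
Qed.

Lemma of_coordK a b c : [/\ c0 (of_coord a b c) = a,
  c1 (of_coord a b c) = b & c2 (of_coord a b c) = c].
Proof.
have e j k : (row j O^T *m O) 0 k = (j == k)%:R.
  by rewrite -row_mul (mulmx1C hO) row1 mxE eqxx/= eq_sym.
have eD (A B : 'rV[R]_3) k : (A + B) 0 k = A 0 k + B 0 k by rewrite mxE.
have eZ s (A : 'rV[R]_3) k : (s *: A) 0 k = s * A 0 k by rewrite mxE.
rewrite /coord /of_coord; split;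
  rewrite !mulmxDl -!scalemxAl !eD !eZ !e/=;
  by rewrite ?(mulr0, mulr1, addr0, add0r).
Qed.

Lemma coordK z : of_coord (c0 z) (c1 z) (c2 z) = z.
Proof.
apply: coord_inj => -[[|[|[|//]]] i3].
- have [+ _ _] := of_coordK (c0 z) (c1 z) (c2 z); congr (coord _ _ = coord _ _); exact: val_inj.
- have [_ + _] := of_coordK (c0 z) (c1 z) (c2 z); congr (coord _ _ = coord _ _); exact: val_inj.
- have [_ _ +] := of_coordK (c0 z) (c1 z) (c2 z); congr (coord _ _ = coord _ _); exact: val_inj.
Qed.

Lemma cts_coord i : continuous (coord i).
Proof.
rewrite /coord (_ : (fun z : 'rV[R]_3 => _) = (fun z => \sum_j z 0 j * O j i)).
  apply: cts_sum => j; apply: ctsM; last exact: cts_cst.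
  exact: coord_continuous.
by apply/funext => z; rewrite mxE.
Qed.

Lemma cts_of_coord (X : topologicalType) (f g h : X -> R) :
  continuous f -> continuous g -> continuous h ->
  continuous (fun x : X => of_coord (f x) (g x) (h x)).
Proof.
move=> cf cg ch.
have cz (k : X -> R) (v : 'rV[R]_3) : continuous k -> continuous (fun x : X => k x *: v).
  by move=> ck x; exact: (cvgZr_tmp (a := v) (ck x)).
move=> x; rewrite /of_coord.
exact: (cvgD (cvgD (cz _ _ cf x) (cz _ _ cg x)) (cz _ _ ch x)).
Qed.

End Frame.
End SphereCoordinates.

Section Chord.
Variables (R : realType) (O : 'M[R]_3) (hO : O *m O^T = 1%:M).
Local Notation i0 := (ord0 : 'I_3).
Local Notation i1 := (lift ord0 ord0 : 'I_3).
Local Notation i2 := (lift ord0 (lift ord0 ord0) : 'I_3).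
Local Notation c0 := (coord O i0).
Local Notation c1 := (coord O i1).
Local Notation c2 := (coord O i2).
Implicit Types x y z w : 'rV[R]_3.

(** With c0, c1, c2 the coordinates in the frame O, the stereographic projection
    from the pole sends x to the complex number (c0 x + i c1 x) / depth x. *)
Definition depth x : R := 1 - c2 x.

(** Half the squared distance of two points of the sphere. *)
Definition gap x z : R := 1 - (c0 x * c0 z + c1 x * c1 z + c2 x * c2 z).

(** Real and imaginary part of the difference of the projections of z and x,
    multiplied by depth x * depth z. *)
Definition diff_re x z : R := c0 z * depth x - c0 x * depth z.
Definition diff_im x z : R := c1 z * depth x - c1 x * depth z.

(** Real and imaginary part of (z - x) conj (z - y), for the projections of the
    three points, up to a positive factor. Since z lies on the sphere, clearing
    the denominators leaves an affine function of z, which is defined and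
    positive at the pole as well. *)
Definition chord_re x y z : R :=
  depth x * depth y * (1 + c2 z) - depth y * (c0 x * c0 z + c1 x * c1 z)
  - depth x * (c0 y * c0 z + c1 y * c1 z)
  + (c0 x * c0 y + c1 x * c1 y) * depth z.
Definition chord_im x y z : R :=
  - (depth y * (c1 x * c0 z - c0 x * c1 z))
  - depth x * (c0 y * c1 z - c1 y * c0 z)
  + (c1 x * c0 y - c0 x * c1 y) * depth z.

Lemma gap_gt0 x z : sphere2 x -> sphere2 z -> x <> z -> 0 < gap x z.
Proof.
move=> /(coord_sphere hO) sx /(coord_sphere hO) sz xz.
have e : gap x z *+ 2 = (c0 x - c0 z) ^+ 2 + (c1 x - c1 z) ^+ 2 + (c2 x - c2 z) ^+ 2.
  transitivity ((c0 x ^+ 2 + c1 x ^+ 2 + c2 x ^+ 2) + (c0 z ^+ 2 + c1 z ^+ 2 + c2 z ^+ 2)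
    - 2 * (c0 x * c0 z + c1 x * c1 z + c2 x * c2 z)); last by ring.
  by rewrite sx sz /gap; ring.
rewrite -(pmulrn_lgt0 _ (ltn0Sn 1)) e lt_neqAle !addr_ge0 ?sqr_ge0// andbT eq_sym.
apply/eqP => /eqP; rewrite paddr_eq0 ?addr_ge0 ?sqr_ge0// paddr_eq0 ?sqr_ge0//.
rewrite !sqrf_eq0 !subr_eq0 => /andP[/andP[/eqP e0 /eqP e1] /eqP e2].
apply: xz; apply: (coord_inj hO) => -[[|[|[|//]]] i3].
- by move: e0; congr (coord O _ _ = coord O _ _); exact: val_inj.
- by move: e1; congr (coord O _ _ = coord O _ _); exact: val_inj.
- by move: e2; congr (coord O _ _ = coord O _ _); exact: val_inj.
Qed.

Lemma gapxx x : sphere2 x -> gap x x = 0.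
Proof. by move=> /(coord_sphere hO) sx; rewrite /gap -!expr2 sx subrr. Qed.

Lemma depth_gt0 n x : sphere2 n -> depth n = 0 -> sphere2 x -> x <> n ->
  0 < depth x.
Proof.
move=> sn hn sx xn; have := gap_gt0 sx sn xn.
move/(coord_sphere hO): sn; move/eqP: hn; rewrite subr_eq0 /gap /depth => /eqP <-.
move=> /eqP; rewrite expr1n -subr_eq0 addrK paddr_eq0 ?sqr_ge0// !sqrf_eq0.
by case/andP => /eqP -> /eqP ->; rewrite !mulr0 !add0r mulr1.
Qed.

Lemma diff_norm x z : sphere2 x -> sphere2 z ->
  diff_re x z ^+ 2 + diff_im x z ^+ 2 = 2 * depth x * depth z * gap x z.
Proof.
move=> /(coord_sphere hO) sx /(coord_sphere hO) sz.
transitivity (2 * depth x * depth z * gap x z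
  + depth x ^+ 2 * (c0 z ^+ 2 + c1 z ^+ 2 + c2 z ^+ 2 - 1)
  + depth z ^+ 2 * (c0 x ^+ 2 + c1 x ^+ 2 + c2 x ^+ 2 - 1)).
  by rewrite /diff_re /diff_im /gap /depth; ring.
by rewrite sx sz !subrr !mulr0 !addr0.
Qed.

Lemma chord_diff_re x y z : sphere2 z ->
  depth z * chord_re x y z = diff_re x z * diff_re y z + diff_im x z * diff_im y z.
Proof.
move=> /(coord_sphere hO) sz.
transitivity (diff_re x z * diff_re y z + diff_im x z * diff_im y z
  - depth x * depth y * (c0 z ^+ 2 + c1 z ^+ 2 + c2 z ^+ 2 - 1)).
  by rewrite /chord_re /diff_re /diff_im /depth; ring.
by rewrite sz subrr mulr0 subr0.
Qed.

Lemma chord_diff_im x y z :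
  depth z * chord_im x y z = diff_im x z * diff_re y z - diff_re x z * diff_im y z.
Proof. by rewrite /chord_im /diff_re /diff_im /depth; ring. Qed.

Lemma chord_pole x y z : sphere2 z -> depth z = 0 ->
  chord_re x y z = 2 * depth x * depth y /\ chord_im x y z = 0.
Proof.
move=> /(coord_sphere hO) sz hz; have e2 : c2 z = 1.
  by move/eqP: hz; rewrite subr_eq0 => /eqP.
move/eqP: sz; rewrite e2 expr1n -subr_eq0 addrK paddr_eq0 ?sqr_ge0// !sqrf_eq0.
case/andP => /eqP e0 /eqP e1.
by rewrite /chord_re /chord_im hz e0 e1 e2; split; ring.
Qed.

(** In particular the chord vanishes at x and y only. *)
Lemma chord_norm x y z : sphere2 x -> sphere2 y -> sphere2 z ->
  chord_re x y z ^+ 2 + chord_im x y z ^+ 2 =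
  4 * depth x * depth y * gap x z * gap y z.
Proof.
move=> sx sy sz; have [hz|hz] := eqVneq (depth z) 0.
  have [-> ->] := chord_pole x y sz hz.
  move/(coord_sphere hO) : (sz); have e2 : c2 z = 1.
    by move/eqP: hz; rewrite subr_eq0 => /eqP.
  move/eqP; rewrite e2 expr1n -subr_eq0 addrK paddr_eq0 ?sqr_ge0// !sqrf_eq0.
  case/andP => /eqP e0 /eqP e1.
  by rewrite /gap e0 e1 e2 /depth; ring.
have hz2 : depth z ^+ 2 != 0 by rewrite expf_neq0.
apply: (mulfI hz2); rewrite mulrDr -!exprMn chord_diff_re// chord_diff_im.
transitivity ((diff_re x z ^+ 2 + diff_im x z ^+ 2) *
  (diff_re y z ^+ 2 + diff_im y z ^+ 2)); first by ring.
by rewrite !diff_norm//; ring.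
Qed.

Lemma chordxx x z : sphere2 x -> sphere2 z ->
  chord_re x x z = 2 * depth x * gap x z /\ chord_im x x z = 0.
Proof.
move=> /(coord_sphere hO) sx sz; split; last by rewrite /chord_im; ring.
transitivity (2 * depth x * gap x z
  + depth z * (c0 x ^+ 2 + c1 x ^+ 2 + c2 x ^+ 2 - 1)).
  by rewrite /chord_re /gap /depth; ring.
by rewrite sx subrr mulr0 addr0.
Qed.

Lemma chord_sym x y z : chord_re y x z = chord_re x y z /\
  chord_im y x z = - chord_im x y z.
Proof. by rewrite /chord_re /chord_im; split; ring. Qed.

(** The two factors in the middle of
    (z - x) conj (z - y) (z - y) conj (z - w) have product |z - y|^2. *)
Lemma chord_mul x y w z : sphere2 z ->
  chord_re x y z * chord_re y w z - chord_im x y z * chord_im y w z =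
    chord_re y y z * chord_re x w z /\
  chord_re x y z * chord_im y w z + chord_im x y z * chord_re y w z =
    chord_re y y z * chord_im x w z.
Proof.
move=> sz; have [hz|hz] := eqVneq (depth z) 0.
  have [-> ->] := chord_pole x y sz hz; have [-> ->] := chord_pole y w sz hz.
  have [-> _] := chord_pole y y sz hz; have [-> ->] := chord_pole x w sz hz.
  by split; ring.
have hz2 : depth z ^+ 2 != 0 by rewrite expf_neq0.
split; apply: (mulfI hz2).
- transitivity ((depth z * chord_re x y z) * (depth z * chord_re y w z) -
    (depth z * chord_im x y z) * (depth z * chord_im y w z)); first by ring.
  transitivity ((depth z * chord_re y y z) * (depth z * chord_re x w z)); last by ring.
  by rewrite !chord_diff_re// !chord_diff_im; ring.
- transitivity ((depth z * chord_re x y z) * (depth z * chord_im y w z) +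
    (depth z * chord_im x y z) * (depth z * chord_re y w z)); first by ring.
  transitivity ((depth z * chord_re y y z) * (depth z * chord_im x w z)); last by ring.
  by rewrite !chord_diff_re// !chord_diff_im; ring.
Qed.

Lemma cts_depth : continuous depth.
Proof. by rewrite /depth; cts; exact: cts_coord. Qed.

Lemma cts_chord_re (X : topologicalType) x (f g : X -> 'rV[R]_3) :
  continuous f -> continuous g -> continuous (fun p : X => chord_re x (f p) (g p)).
Proof.
move=> cf cg.
have cF i : continuous (fun p : X => coord O i (f p)) by apply: cts_comp => //; exact: cts_coord.
have cG i : continuous (fun p : X => coord O i (g p)) by apply: cts_comp => //; exact: cts_coord.
by rewrite /chord_re /depth; cts;
  lazymatch goal with |- continuous (fun p => coord O _ (f p)) => exact: cF | _ => exact: cG end.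
Qed.

Lemma cts_chord_im (X : topologicalType) x (f g : X -> 'rV[R]_3) :
  continuous f -> continuous g -> continuous (fun p : X => chord_im x (f p) (g p)).
Proof.
move=> cf cg.
have cF i : continuous (fun p : X => coord O i (f p)) by apply: cts_comp => //; exact: cts_coord.
have cG i : continuous (fun p : X => coord O i (g p)) by apply: cts_comp => //; exact: cts_coord.
by rewrite /chord_im /depth; cts;
  lazymatch goal with |- continuous (fun p => coord O _ (f p)) => exact: cF | _ => exact: cG end.
Qed.

(** An equivalence of points that are outside U and not the pole. It relates the
    two ends of any curve outside U, but not x and y if U is the sphere without
    x and y. *)
Definition chord_arg (U : set 'rV[R]_3) x y := exists t : 'rV[R]_3 -> R,
  {within U, continuous t} /\
  forall z, U z -> has_arg (chord_re x y z) (chord_im x y z) (t z).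

Lemma chord_arg_sym U x y : chord_arg U x y -> chord_arg U y x.
Proof.
move=> [t [ct ht]]; exists (fun z => - t z); split; first exact: ctsN.
move=> z Uz; have [-> ->] := chord_sym x y z.
by apply: has_arg_conj; exact: ht.
Qed.

Lemma chord_arg_refl U x : U `<=` @sphere2 R -> sphere2 x -> ~ U x -> 0 < depth x ->
  chord_arg U x x.
Proof.
move=> US sx Ux hx; exists (fun=> 0); split; first exact: cts_cst.
move=> z Uz; have [-> ->] := chordxx sx (US _ Uz).
apply: has_arg_pos; rewrite !mulr_gt0//; apply: gap_gt0 => //; first exact: US.
by move=> e; apply: Ux; rewrite e.
Qed.

Lemma chord_arg_trans U x y w : U `<=` @sphere2 R -> sphere2 y -> ~ U y ->
  0 < depth y -> chord_arg U x y -> chord_arg U y w -> chord_arg U x w.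
Proof.
move=> US sy Uy hy [t [ct ht]] [u [cu hu]].
exists (fun z => t z + u z); split; first exact: ctsD.
move=> z Uz; have sz := US _ Uz; have := has_argM (ht z Uz) (hu z Uz).
have [-> ->] := chord_mul x y w sz; have [-> _] := chordxx sy sz.
have k0 : 0 < 2 * depth y * gap y z.
  rewrite !mulr_gt0//; apply: gap_gt0 => // e; apply: Uy; rewrite e//.
move=> /(@has_argZ _ (2 * depth y * gap y z)^-1); rewrite invr_gt0 => /(_ k0).
by rewrite !mulKf ?gt_eqF.
Qed.

(** The homotopy moves the second point along the curve; at its start the
    function is a squared modulus, so its argument is 0. *)
Lemma chord_arg_curve (U : set 'rV[R]_3) (gam : R -> 'rV[R]_3) :
  U `<=` @sphere2 R -> {within `[0, 1], continuous gam} ->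
  (forall t, `[0, 1]%classic t ->
    [/\ sphere2 (gam t), ~ U (gam t) & 0 < depth (gam t)]) ->
  chord_arg U (gam 0) (gam 1).
Proof.
move=> US cgam gP; pose k : R -> R := clamp 1.
have k01 s : `[0, 1]%classic (k s).
  by rewrite /= in_itv/= /k /clamp le_min ge_min le_max !lexx !orbT ler01.
have ck : continuous (fun s => gam (k s)).
  by apply: cts_within_comp k01 => //; exact: cts_clamp.
have kid s : 0 <= s <= 1 -> k s = s.
  by case/andP => s0 s1; rewrite /k /clamp max_l// min_l.
have k0 : k 0 = 0 by apply: kid; rewrite lexx ler01.
have k1 : k 1 = 1 by apply: kid; rewrite lexx ler01.
have in0 : `[0, 1]%classic (0 : R) by rewrite /= in_itv/= lexx ler01.
pose F (p : 'rV[R]_3 * R) := chord_re (gam 0) (gam (k p.2)) p.1.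
pose G (p : 'rV[R]_3 * R) := chord_im (gam 0) (gam (k p.2)) p.1.
have c1 : continuous (fst : 'rV[R]_3 * R -> 'rV[R]_3) by move=> p; exact: cvg_fst.
have c2 : continuous (snd : 'rV[R]_3 * R -> R) by move=> p; exact: cvg_snd.
have cg : continuous (fun p : 'rV[R]_3 * R => gam (k p.2)) by exact: (cts_comp c2 ck).
have sU z s : U z -> 0 < gap (gam (k s)) z.
  move=> Uz; have [sg ng _] := gP _ (k01 s).
  by apply: gap_gt0 => //; [exact: US|move=> e; apply: ng; rewrite e].
have [sg0 _ hg0] := gP _ in0.
have [||z s Uz _|z Uz|t [ct ht]] := @homotopy_arg _ _ U F G 0.
- exact: cts_chord_re.
- exact: cts_chord_im.
- have [sg _ hg] := gP _ (k01 s).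
  rewrite /F /G/= chord_norm//; last exact: US.
  rewrite !mulf_neq0 ?gt_eqF//; last exact: sU.
  by have := sU z 0 Uz; rewrite k0.
- rewrite /F /G/= k0; have [-> ->] := chordxx sg0 (US _ Uz).
  by apply: has_arg_pos; rewrite !mulr_gt0//; have := sU z 0 Uz; rewrite k0.
- by exists t; split=> // z Uz; have := ht z Uz; rewrite /F /G/= k1.
Qed.

(** The inverse of the stereographic projection. *)
Definition stereo (a b : R) : 'rV[R]_3 :=
  of_coord O (2 * a / (1 + a ^+ 2 + b ^+ 2)) (2 * b / (1 + a ^+ 2 + b ^+ 2))
    ((a ^+ 2 + b ^+ 2 - 1) / (1 + a ^+ 2 + b ^+ 2)).

Lemma stereo_den a b : 0 < 1 + a ^+ 2 + b ^+ 2 :> R.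
Proof. by rewrite -addrA ltr_pwDl// addr_ge0// sqr_ge0. Qed.

Lemma coord_stereo a b : [/\ c0 (stereo a b) = 2 * a / (1 + a ^+ 2 + b ^+ 2),
  c1 (stereo a b) = 2 * b / (1 + a ^+ 2 + b ^+ 2) &
  c2 (stereo a b) = (a ^+ 2 + b ^+ 2 - 1) / (1 + a ^+ 2 + b ^+ 2)].
Proof. by have [] := of_coordK hO (2 * a / (1 + a ^+ 2 + b ^+ 2))
  (2 * b / (1 + a ^+ 2 + b ^+ 2)) ((a ^+ 2 + b ^+ 2 - 1) / (1 + a ^+ 2 + b ^+ 2)). Qed.

Lemma depth_stereo a b : depth (stereo a b) = 2 / (1 + a ^+ 2 + b ^+ 2).
Proof.
rewrite /depth; have [_ _ ->] := coord_stereo a b.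
by field; rewrite gt_eqF// stereo_den.
Qed.

Lemma stereo_sphere a b : sphere2 (stereo a b).
Proof.
apply/(coord_sphere hO); have [-> -> ->] := coord_stereo a b.
by field; rewrite gt_eqF// stereo_den.
Qed.

Lemma cts_stereo (X : topologicalType) (f g : X -> R) :
  continuous f -> continuous g -> continuous (fun x : X => stereo (f x) (g x)).
Proof.
move=> cf cg.
have cd : continuous (fun x : X => (1 + f x ^+ 2 + g x ^+ 2)^-1).
  by apply: ctsV => [x|]; [rewrite gt_eqF// stereo_den|cts].
by apply: cts_of_coord; cts.
Qed.

Lemma diff_stereo x a b :
  diff_re x (stereo a b) = 2 / (1 + a ^+ 2 + b ^+ 2) * (a * depth x - c0 x) /\
  diff_im x (stereo a b) = 2 / (1 + a ^+ 2 + b ^+ 2) * (b * depth x - c1 x).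
Proof.
have [e0 e1 _] := coord_stereo a b.
rewrite /diff_re /diff_im e0 e1 depth_stereo.
by split; field; rewrite gt_eqF// stereo_den.
Qed.

Lemma chord_stereo x y a b :
  chord_re x y (stereo a b) = 2 / (1 + a ^+ 2 + b ^+ 2) *
    ((a * depth x - c0 x) * (a * depth y - c0 y) +
     (b * depth x - c1 x) * (b * depth y - c1 y)) /\
  chord_im x y (stereo a b) = 2 / (1 + a ^+ 2 + b ^+ 2) *
    ((b * depth x - c1 x) * (a * depth y - c0 y) -
     (a * depth x - c0 x) * (b * depth y - c1 y)).
Proof.
have [e0 e1 e2] := coord_stereo a b.
rewrite /chord_re /chord_im depth_stereo e0 e1 e2.
by split; field; rewrite gt_eqF// stereo_den.
Qed.

(** Along a small circle about the projection of x, the factor z - x turns once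
    while conj (z - y) stays in a half-plane. *)
Lemma no_chord_arg x y : sphere2 x -> sphere2 y -> 0 < depth x -> 0 < depth y ->
  x <> y -> ~ chord_arg (@sphere2 R `\` [set x; y]) x y.
Proof.
move=> sx sy hx hy xy [th [cth hth]].
have hx0 : depth x != 0 by rewrite gt_eqF.
have hy0 : depth y != 0 by rewrite gt_eqF.
pose d1 := c0 x / depth x - c0 y / depth y.
pose d2 := c1 x / depth x - c1 y / depth y.
pose n2 := d1 ^+ 2 + d2 ^+ 2.
have n20 : 0 < n2.
  have := diff_norm sx sy; have g0 := gap_gt0 sx sy xy.
  have -> : diff_re x y = - (depth x * depth y * d1).
    by rewrite /d1 /diff_re; field; rewrite hx0 hy0.
  have -> : diff_im x y = - (depth x * depth y * d2).
    by rewrite /d2 /diff_im; field; rewrite hx0 hy0.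
  rewrite !sqrrN !(exprMn _ (_ * _)) -mulrDr -/n2 => e.
  have : 0 < (depth x * depth y) ^+ 2 * n2 by rewrite e !mulr_gt0.
  by rewrite pmulr_rgt0// exprn_gt0// mulr_gt0.
(* The circle about the projection of x through the midpoint of the two
   projections. *)
pose a t := c0 x / depth x + (d1 * cos t - d2 * sin t) / 2.
pose b t := c1 x / depth x + (d1 * sin t + d2 * cos t) / 2.
have cc : continuous (@cos R) by exact: continuous_cos.
have cs : continuous (@sin R) by exact: continuous_sin.
have ca : continuous a by rewrite /a; cts.
have cb : continuous b by rewrite /b; cts.
pose u t : R := 1 + cos t / 2; pose v t : R := - (sin t / 2).
have u0 t : 0 < u t by rewrite /u; have := cos_geN1 t; lra.
pose k t := 2 / (1 + a t ^+ 2 + b t ^+ 2) * (depth x * depth y * n2 / 2).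
have k0 t : 0 < k t.
  by rewrite /k !mulr_gt0 ?invr_gt0 ?stereo_den.
have cre t : chord_re x y (stereo (a t) (b t)) = k t * (cos t * u t - sin t * v t).
  have [-> _] := chord_stereo x y (a t) (b t).
  transitivity (2 / (1 + a t ^+ 2 + b t ^+ 2) * (depth x * depth y * n2 / 2 *
    (cos t * u t - sin t * v t))); last by rewrite /k mulrA.
  congr (_ * _).
  have -> : cos t * u t - sin t * v t = cos t + (cos t ^+ 2 + sin t ^+ 2) / 2.
    by rewrite /u /v; field.
  rewrite cos2Dsin2.
  transitivity (depth x * depth y * n2 / 2 * (cos t + (cos t ^+ 2 + sin t ^+ 2) / 2)).
    by rewrite /a /b /n2 /d1 /d2; field; rewrite hx0 hy0.
  by rewrite cos2Dsin2.
have cim t : chord_im x y (stereo (a t) (b t)) = k t * (cos t * v t + sin t * u t).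
  have [_ ->] := chord_stereo x y (a t) (b t).
  transitivity (2 / (1 + a t ^+ 2 + b t ^+ 2) * (depth x * depth y * n2 / 2 *
    (cos t * v t + sin t * u t))); last by rewrite /k mulrA.
  congr (_ * _).
  by rewrite /a /b /n2 /d1 /d2 /u /v; field; rewrite hx0 hy0.
have Ut t : (@sphere2 R `\` [set x; y]) (stereo (a t) (b t)).
  split; first exact: stereo_sphere.
  have := chord_norm sx sy (stereo_sphere (a t) (b t)); rewrite cre cim.
  have -> : (k t * (cos t * u t - sin t * v t)) ^+ 2 +
    (k t * (cos t * v t + sin t * u t)) ^+ 2 =
    k t ^+ 2 * (cos t ^+ 2 + sin t ^+ 2) * (u t ^+ 2 + v t ^+ 2) by ring.
  rewrite cos2Dsin2 mulr1 => e.
  have : 0 < k t ^+ 2 * (u t ^+ 2 + v t ^+ 2).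
    by rewrite mulr_gt0 ?exprn_gt0// ltr_pwDl ?exprn_gt0// sqr_ge0.
  rewrite e => /[swap] -[] -> ; rewrite gapxx// ?mulr0 ?mul0r ltxx//.
apply: (@circle_no_arg R u v (fun t => th (stereo (a t) (b t)))) => //.
- by rewrite /u; cts.
- by rewrite /v; cts.
- by apply: cts_within_comp Ut => //; exact: cts_stereo.
- by rewrite /u cos2pi cos0.
- by rewrite /v sin2pi sin0.
- by rewrite /a /b cos2pi cos0 sin2pi sin0.
move=> t; have := hth _ (Ut t); rewrite cre cim.
move=> /(@has_argZ _ (k t)^-1); rewrite invr_gt0 => /(_ (k0 t)).
by rewrite !mulKf ?gt_eqF.
Qed.

End Chord.

(** * Compact subsets of the sphere that do not separate it *)

Section NoSeparation.
Variable R : realType.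
Local Notation i0 := (ord0 : 'I_3).
Local Notation i1 := (lift ord0 ord0 : 'I_3).
Local Notation i2 := (lift ord0 (lift ord0 ord0) : 'I_3).

Lemma has_arg_normalize (a b t : R) : has_arg a b t ->
  a / Num.sqrt (a ^+ 2 + b ^+ 2) = cos t /\ b / Num.sqrt (a ^+ 2 + b ^+ 2) = sin t.
Proof.
move=> [r r0 [-> ->]]; rewrite !exprMn -mulrDr cos2Dsin2 mulr1 sqrtr_sqr gtr0_norm//.
by split; rewrite mulrC mulKf// gt_eqF.
Qed.

(** For compact K this is the vanishing of the first Cech cohomology group. *)
Definition args_lift (K : set 'rV[R]_3) := forall f g : 'rV[R]_3 -> R,
  continuous f -> continuous g -> (forall z, K z -> f z ^+ 2 + g z ^+ 2 != 0) ->
  exists t : 'rV[R]_3 -> R, {within K, continuous t} /\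
    forall z, K z -> has_arg (f z) (g z) (t z).

(** Project from b, so that f, the position relative to the projection of a,
    vanishes at a only. An argument of f on K extends to a continuous function
    T by the theorem of Tietze. Replacing f by the unit vector of argument T on
    W, which contains a, gives a continuous map from the plane to the circle.
    It winds once around any large circle; but the plane is contractible. *)
Lemma not_separated (K W W' : set 'rV[R]_3) a b :
  compact K -> args_lift K ->
  K `|` W `|` W' = @sphere2 R ->
  (forall z, W z -> ~ K z) -> (forall z, W z -> ~ W' z) -> 
  closed (W `|` K) -> closed (W' `|` K) -> W a -> W' b -> ~ K b -> False.
Proof.
move=> cK lift cover WK WW' clW clW' Wa Wb nKb.
have sa : sphere2 a by rewrite -cover; left; right.
have sb : sphere2 b by rewrite -cover; right.
have sK z : K z -> sphere2 z by move=> Kz; rewrite -cover; left; left.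
have [Q [hO bO]] := rotate_to_pole sb.
have hb : depth Q b = 0.
  by rewrite /depth /coord bO mxE !eqxx subrr.
have hgt0 z : sphere2 z -> z <> b -> 0 < depth Q z by exact: depth_gt0.
have ha : 0 < depth Q a.
  by apply: hgt0 => // e; apply: (WW' _ Wa); rewrite e.
have diff0 z : sphere2 z -> z <> a -> z <> b ->
    diff_re Q a z ^+ 2 + diff_im Q a z ^+ 2 != 0.
  move=> sz za zb; rewrite diff_norm// gt_eqF// !mulr_gt0//; first exact: hgt0.
  by apply: gap_gt0 => // e; apply: za.
have cdr : continuous (diff_re Q a).
  by rewrite /diff_re; cts; [exact: cts_coord|exact: cts_depth].
have cdi : continuous (diff_im Q a).
  by rewrite /diff_im; cts; [exact: cts_coord|exact: cts_depth].
have [z Kz|th [cth hth]] := lift _ _ cdr cdi.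
  by apply: diff0; [exact: sK|move=> e; apply: (WK _ Wa); rewrite -e
                   |move=> e; apply: nKb; rewrite -e].
have clK : closed K by apply: compact_closed cK; exact: norm_hausdorff.
have [M M0 thM] : exists2 M, 0 < M & forall z, K z -> `|th z| <= M.
  have /compact_bounded[M [_ hM]] : compact (th @` K : set R).
    exact: continuous_compact.
  exists (Num.max M 0 + 1); first by rewrite ltr_wpDl// le_max lexx orbT.
  move=> z Kz; apply: (hM (Num.max M 0 + 1)); last by exists z.
  by rewrite ltr_pwDr// le_max lexx.
have [T [TE cT _]] := continuous_bounded_extension
  (@pseudometric_normal R 'rV[R]_3) clK M0 cth thM.
pose phi (p : R * R) := stereo Q p.1 p.2.
have c1 : continuous (fst : R * R -> R) by move=> p; exact: cvg_fst.
have c2 : continuous (snd : R * R -> R) by move=> p; exact: cvg_snd.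
have cphi : continuous phi by exact: cts_stereo.
have sphi p : sphere2 (phi p) by exact: stereo_sphere.
have hphi p : 0 < depth Q (phi p).
  by rewrite depth_stereo// divr_gt0// stereo_den.
have phib p : phi p <> b by move=> e; have := hphi p; rewrite e hb ltxx.
(* The value of f at phi p, up to a positive factor. *)
pose F1 (p : R * R) := p.1 * depth Q a - coord Q i0 a.
pose F2 (p : R * R) := p.2 * depth Q a - coord Q i1 a.
pose nF p := Num.sqrt (F1 p ^+ 2 + F2 p ^+ 2).
have cF1 : continuous F1 by rewrite /F1; cts.
have cF2 : continuous F2 by rewrite /F2; cts.
have cnF : continuous nF.
  apply: (@cts_comp _ _ _ (fun p => F1 p ^+ 2 + F2 p ^+ 2) Num.sqrt); first by cts.
  exact: sqrt_continuous.
have dphi p : diff_re Q a (phi p) = 2 / (1 + p.1 ^+ 2 + p.2 ^+ 2) * F1 p /\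
    diff_im Q a (phi p) = 2 / (1 + p.1 ^+ 2 + p.2 ^+ 2) * F2 p.
  exact: diff_stereo.
have den p : 0 < 2 / (1 + p.1 ^+ 2 + p.2 ^+ 2) :> R by rewrite divr_gt0// stereo_den.
have F0 p : ~ W (phi p) -> F1 p ^+ 2 + F2 p ^+ 2 != 0.
  move=> nW; have pa : phi p <> a by move=> e; apply: nW; rewrite e.
  have := diff0 (phi p) (sphi p) pa (phib p).
  have [-> ->] := dphi p; rewrite !exprMn -mulrDr mulf_eq0 negb_or.
  by case/andP.
have nF0 p : ~ W (phi p) -> nF p != 0.
  by move/F0 => h; rewrite gt_eqF// sqrtr_gt0 lt_neqAle eq_sym h addr_ge0// sqr_ge0.
pose h1 p := if `[< W (phi p) >] then cos (T (phi p)) else F1 p / nF p.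
pose h2 p := if `[< W (phi p) >] then sin (T (phi p)) else F2 p / nF p.
have hh p : h1 p ^+ 2 + h2 p ^+ 2 = 1.
  rewrite /h1 /h2; case: asboolP => [_|nW]; first exact: cos2Dsin2.
  rewrite !expr_div_n -mulrDl sqr_sqrtr ?addr_ge0 ?sqr_ge0// divff// F0//.
have hK p : K (phi p) -> F1 p / nF p = cos (T (phi p)) /\ F2 p / nF p = sin (T (phi p)).
  move=> Kp; apply: has_arg_normalize; rewrite -TE ?inE//.
  have := hth _ Kp; have [-> ->] := dphi p.
  move=> /(@has_argZ _ (2 / (1 + p.1 ^+ 2 + p.2 ^+ 2))^-1).
  by rewrite invr_gt0 => /(_ (den p)); rewrite !mulKf// gt_eqF.
have glue (h c : R * R -> R) (s : R -> R) : continuous s -> continuous c ->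
    (forall p, h p = if `[< W (phi p) >] then s (T (phi p)) else c p / nF p) ->
    (forall p, K (phi p) -> c p / nF p = s (T (phi p))) -> continuous h.
  move=> cs cc hE hKE.
  have e : phi @^-1` (W `|` K) `|` phi @^-1` (W' `|` K) = setT.
    apply/seteqP; split => // p _; have : (@sphere2 R) (phi p) by [].
    by rewrite -cover => -[[Kp|Wp]|Wp]; [left; right|left; left|right; left].
  suff : {within setT, continuous h}.
    by move=> ch; exact: (cts_within_comp (@cts_id _) ch (fun=> I)).
  rewrite -e; apply: withinU_continuous; try by apply: preimage_closed => // p _; exact: cphi.
    apply: (@subspace_eq_continuous _ _ _ (fun p => s (T (phi p)))); last first.
      by apply: continuous_subspaceT; exact: cts_comp (cts_comp cphi cT) cs.
    move=> p /set_mem Hp; rewrite /from_subspace hE; case: Hp => [Wp|Kp]; first by rewrite asboolT.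
    by case: asboolP => // _; rewrite hKE.
  have nWp p : (phi @^-1` (W' `|` K)) p -> ~ W (phi p).
    by move=> [Wp Wp'|Kp Wp]; [exact: (WW' _ Wp' Wp)|exact: (WK _ Wp)].
  apply: (@subspace_eq_continuous _ _ _ (fun p => c p * (nF p)^-1)).
    by move=> p /set_mem/nWp nW; rewrite /from_subspace hE asboolF.
  apply: ctsM; first exact: continuous_subspaceT.
  by apply: ctsV_on => // p /nWp; exact: nF0.
have ch1 : continuous h1.
  by apply: (glue h1 F1 cos) => //; [exact: continuous_cos|move=> p /hK[]].
have ch2 : continuous h2.
  by apply: (glue h2 F2 sin) => //; [exact: continuous_sin|move=> p /hK[]].
have [a0 ha0] : exists t, has_arg (h1 (0, 0)) (h2 (0, 0)) t.
  by apply: has_arg_exists; rewrite hh oner_eq0.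
pose H (h : R * R -> R) (q : R * R * R) := h (q.2 * q.1.1, q.2 * q.1.2).
have cH h : continuous h -> continuous (H h).
  move=> ch.
  have d1 : continuous (fst : R * R * R -> R * R) by move=> p; exact: cvg_fst.
  have d2 : continuous (snd : R * R * R -> R) by move=> p; exact: cvg_snd.
  have d3 : continuous (fun q : R * R * R => q.1.1) by exact: (cts_comp d1 c1).
  have d4 : continuous (fun q : R * R * R => q.1.2) by exact: (cts_comp d1 c2).
  by apply: (@cts_comp _ _ _ (fun q : R * R * R => (q.2 * q.1.1, q.2 * q.1.2)) h) => //;
     apply: cts_pair; cts.
have [||t [ct ht]] := @homotopy_arg R (R * R)%type setT (H h1) (H h2) a0 (cH _ ch1) (cH _ ch2).
- by move=> p s _ _; rewrite /H hh oner_eq0.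
- by move=> p _; rewrite /H/= !mul0r.
have {}ct : continuous t by exact: (cts_within_comp (@cts_id _) ct (fun=> I)).
(* A neighbourhood of b avoids W, and phi p lies in it for large p. *)
have [e e0 he] : exists2 e : R, 0 < e & forall u v w, `|u| < e -> `|v| < e ->
    `|1 - w| < e -> ~ W (of_coord Q u v w).
  pose j (q : R * R * R) := of_coord Q q.1.1 q.1.2 q.2.
  have d1 : continuous (fst : R * R * R -> R * R) by move=> p; exact: cvg_fst.
  have d2 : continuous (snd : R * R * R -> R) by move=> p; exact: cvg_snd.
  have d3 : continuous (fun q : R * R * R => q.1.1) by exact: (cts_comp d1 c1).
  have d4 : continuous (fun q : R * R * R => q.1.2) by exact: (cts_comp d1 c2).
  have cj : continuous j by exact: cts_of_coord.
  have jb : j ((0, 0), 1) = b.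
    by rewrite -[RHS](coordK hO) /coord bO !mxE.
  have : nbhs (j ((0, 0), 1)) (~` (W `|` K)).
    apply: open_nbhs_nbhs; split; first exact: closed_openC.
    by rewrite jb => -[Wb'|]; [exact: (WW' _ Wb')|].
  move=> /(cj _) /nbhs_ballP[e /= e0 he]; exists e => // u v w ue ve we Wj.
  apply: (he ((u, v), w)); last by left.
  by split; [split|]; rewrite /ball/= ?sub0r ?normrN.
pose k0 := coord Q i0 a; pose k1 := coord Q i1 a.
(* The circle of radius r surrounds the projection of a and is mapped by phi
   into that neighbourhood. *)
pose r := 1 + 2 / e + (`|k0| + `|k1|) / depth Q a.
have r1 : 1 + 2 / e <= r.
  by rewrite /r lerDl; apply: divr_ge0; [exact: addr_ge0|exact: ltW].
have r0 : 1 < r by rewrite (lt_le_trans _ r1)// ltrDl divr_gt0.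
have re : 2 / r < e.
  by rewrite ltr_pdivrMr ?(lt_trans _ r0)// mulrC -ltr_pdivrMr// (lt_le_trans _ r1)// ltrDr.
have rk : `|k0| + `|k1| < r * depth Q a.
  rewrite -ltr_pdivrMr// /r ltrDr; apply: addr_gt0 => //; exact: divr_gt0.
pose g s : R * R := (r * cos s, r * sin s).
have cg : continuous g.
  by apply: cts_pair; cts; [exact: continuous_cos|exact: continuous_sin].
have gW s : ~ W (phi (g s)).
  have den2 : 1 + (r * cos s) ^+ 2 + (r * sin s) ^+ 2 = 1 + r ^+ 2.
    by rewrite !exprMn -addrA -mulrDr cos2Dsin2 mulr1.
  have den3 : (r * cos s) ^+ 2 + (r * sin s) ^+ 2 - 1 = r ^+ 2 - 1.
    by rewrite !exprMn -mulrDr cos2Dsin2 mulr1.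
  have q0 : 0 < 1 + r ^+ 2 by rewrite ltr_pwDl// sqr_ge0.
  have qr : 2 * r / (1 + r ^+ 2) < e.
    apply: lt_trans re; rewrite ltr_pdivrMr// -mulrA ltr_pM2l// -ltr_pdivrMl ?invr_gt0 ?(lt_trans _ r0)//.
    by rewrite invrK -expr2 ltrDr.
  have qc c : `|c| <= 1 -> `|2 * (r * c) / (1 + r ^+ 2)| < e.
    move=> c1'; apply: le_lt_trans qr; rewrite normrM normfV (gtr0_norm q0).
    rewrite ler_pM2r ?invr_gt0// normrM (gtr0_norm (ltr0n _ 2))// ler_pM2l//.
    by rewrite normrM (gtr0_norm (lt_trans ltr01 r0)) ler_piMr// ltW// (lt_trans _ r0).
  apply: he => /=; rewrite ?den2 ?den3.
  - by apply: qc; exact: cos_max.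
  - by apply: qc; exact: sin_max.
  - have -> : 1 - (r ^+ 2 - 1) / (1 + r ^+ 2) = 2 / (1 + r ^+ 2).
      by field; rewrite gt_eqF.
    rewrite gtr0_norm ?divr_gt0//; apply: lt_trans qr.
    by rewrite ltr_pM2r ?invr_gt0// ltr_pMr.
pose u s := r * depth Q a - (k0 * cos s + k1 * sin s).
pose v s := - (k1 * cos s - k0 * sin s).
apply: (@circle_no_arg R u v (t \o g)).
- by rewrite /u; cts; [exact: continuous_cos|exact: continuous_sin].
- by rewrite /v; cts; [exact: continuous_cos|exact: continuous_sin].
- exact: cts_comp cg ct.
- move=> s; rewrite /u subr_gt0 (le_lt_trans _ rk)// lerD//.
    rewrite (le_trans (ler_norm _))// normrM ler_piMr// cos_max//.
  by rewrite (le_trans (ler_norm _))// normrM ler_piMr// sin_max.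
- by rewrite /u cos2pi cos0 sin2pi sin0.
- by rewrite /v cos2pi cos0 sin2pi sin0.
- by rewrite /g /= cos2pi cos0 sin2pi sin0.
move=> s; have := ht (g s) I; rewrite /H/= !mul1r -/(g s) /h1 /h2.
rewrite asboolF; last exact: gW.
have n0 : 0 < nF (g s) by rewrite lt_neqAle eq_sym nF0//= sqrtr_ge0.
move=> /(has_argZ n0).
rewrite ![nF _ * _]mulrC !divfK ?gt_eqF//.
have cs1 := cos2Dsin2 s.
congr has_arg; rewrite /F1 /F2 /u /v /= -/k0 -/k1.
  transitivity (r * cos s * depth Q a - k0 * (cos s ^+ 2 + sin s ^+ 2)).
    by rewrite cs1 mulr1.
  ring.
transitivity (r * sin s * depth Q a - k1 * (cos s ^+ 2 + sin s ^+ 2)).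
  by rewrite cs1 mulr1.
ring.
Qed.

End NoSeparation.

(** * Components, forests and the cycle space of a graph *)

Section Components.
Variable G : graph.
Implicit Types (A B C D T : {set edge G}) (e : edge G) (x y z : vertex G).
Local Open Scope nat_scope.

Definition linked_in A := connect (adjacent_in A).
Definition joined A e := linked_in A (ends e).1 (ends e).2.

Lemma adjacent_in_sym A : symmetric (adjacent_in A).
Proof. by move=> x y; apply: eq_existsb => e; rewrite orbC. Qed.

Lemma linked_in_sym A : connect_sym (adjacent_in A).
Proof. exact/sym_connect_sym/adjacent_in_sym. Qed.

Lemma adjacent_inU A e x y : adjacent_in (e |: A) x y =
  [|| adjacent_in A x y, ends e == (x, y) | ends e == (y, x)].
Proof.
apply/exists_inP/idP => [[f]|].
  by rewrite finset.in_setU1 => /orP[/eqP-> ->|fA h]; rewrite ?orbT//; apply/orP; left;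
    apply/exists_inP; exists f.
case/orP => [/exists_inP[f fA h]|h]; first by exists f => //; rewrite finset.in_setU1 fA orbT.
by exists e => //; rewrite finset.setU11.
Qed.

Lemma linked_inS A B x y : A \subset B -> linked_in A x y -> linked_in B x y.
Proof.
move=> AB; apply: connect_sub => u v /exists_inP[e eA h].
by apply/connect1/exists_inP; exists e => //; exact: (fintype.subsetP AB e eA).
Qed.

Lemma joined_mem A e : e \in A -> joined A e.
Proof.
move=> eA; apply/connect1/exists_inP; exists e => //.
by rewrite -surjective_pairing eqxx.
Qed.

Lemma joinedS A B e : A \subset B -> joined A e -> joined B e.
Proof. exact: linked_inS. Qed.

Lemma linked_in_joined A e x y : joined A e ->
  linked_in (e |: A) x y = linked_in A x y.
Proof.
move=> je; apply/idP/idP; last exact/linked_inS/finset.subsetUr.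
apply: connect_sub => u v; rewrite adjacent_inU => /or3P[/connect1//|/eqP h|/eqP h].
  by move: je; rewrite /joined h.
by rewrite linked_in_sym; move: je; rewrite /joined h.
Qed.

Lemma ncomponents_joined A e : joined A e -> ncomponents (e |: A) = ncomponents A.
Proof. by move=> je; apply: eq_n_comp => x y; exact: linked_in_joined. Qed.

(** The classes of the two ends of e merge, and no other class changes. *)
Lemma ncomponents_unjoined A e : ~~ joined A e ->
  ncomponents A = (ncomponents (e |: A)).+1.
Proof.
move=> je; set x := (ends e).1; set y := (ends e).2.
pose b : {pred vertex G} := [pred z | linked_in A z x || linked_in A z y].
have out z w : z \notin b -> linked_in (e |: A) z w = linked_in A z w.
  rewrite inE negb_or => /andP[zx zy]; apply/idP/idP; last exact/linked_inS/finset.subsetUr.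
  move=> zw; have cl : fingraph.closed (adjacent_in (e |: A)) [pred w | linked_in A z w].
    apply: intro_closed; first exact: linked_in_sym.
    move=> u v; rewrite adjacent_inU !inE => /or3P[uv zu|/eqP h zu|/eqP h zu].
    - exact: connect_trans zu (connect1 uv).
    - by move: zx; rewrite /x h zu.
    - by move: zy; rewrite /y h zu.
  have := closed_connect cl zw; rewrite !inE => <-; exact: connect0.
have memb C z : (z \in fingraph.closure (adjacent_in C) (pred2 x y)) =
    linked_in C z x || linked_in C z y.
  rewrite -[LHS]/(~~ [disjoint connect (adjacent_in C) z & pred2 x y]).
  apply/pred0Pn/orP => [[w]|[zx|zy]].
  - by rewrite !inE => /andP[zw /orP[/eqP <-|/eqP <-]]; [left|right].
  - by exists x; rewrite !inE eqxx andbT.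
  - by exists y; rewrite !inE eqxx orbT andbT.
have bA : b =i fingraph.closure (adjacent_in A) (pred2 x y).
  by move=> z; rewrite memb.
have beA : b =i fingraph.closure (adjacent_in (e |: A)) (pred2 x y).
  move=> z; rewrite memb; have [zb|zb] := boolP (z \in b).
    by apply/esym; move: zb; rewrite inE => /orP[] /(linked_inS (finset.subsetUr [set e]%SET A)) ->;
      rewrite ?orbT.
  by rewrite !out//; apply/esym/negbTE.
rewrite /ncomponents (n_compC b (adjacent_in A)) (n_compC b (adjacent_in (e |: A))).
rewrite (eq_n_comp_r bA) (eq_n_comp_r beA).
rewrite !n_comp_closure2; [|exact: linked_in_sym..].
have -> : connect (adjacent_in (e |: A)) x y by exact: joined_mem (finset.setU11 _ _).
rewrite [connect _ _ _](negbTE je) /= add1n add2n; congr _.+2.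
apply: eq_card => z; rewrite !inE; case: (boolP (z \in b)); rewrite inE => zb.
  by rewrite zb !andbF.
have ze : pick (connect (adjacent_in A) z) = pick (connect (adjacent_in (e |: A)) z).
    by apply: eq_pick => w; apply/esym/out.
  by congr (_ && _); rewrite /fingraph.roots /fingraph.root ze.
Qed.

Lemma set_subset_ind (P : {set edge G} -> Prop) A B : A \subset B -> P A ->
  (forall C e, A \subset C -> e \notin C -> P C -> P (e |: C)) -> P B.
Proof.
move=> + PA step; elim: {B}#|B| {-2}B (erefl #|B|) => [|n IH] B cB AB.
  have -> // : B = A.
  by apply/eqP; rewrite finset.eqEsubset AB andbT; move/eqP: cB; rewrite cards_eq0 => /eqP->; rewrite finset.sub0set.
have [->//|BA] := eqVneq B A.
have /fintype.properP[_ [e eB eA]] : A \proper B by rewrite finset.properEneq eq_sym BA.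
rewrite -(finset.setD1K eB); apply: step.
- by apply/fintype.subsetP => f fA; rewrite !inE (fintype.subsetP AB)// andbT; apply: contraNneq eA => <-.
- by rewrite finset.setD11.
apply: IH; first by apply/eqP; rewrite -eqSS -cB (cardsD1 e B) eB.
by apply/fintype.subsetP => f fA; rewrite !inE (fintype.subsetP AB)// andbT; apply: contraNneq eA => <-.
Qed.

(** The dimension |A| - |V| + c(A) of the cycle space, shifted by |V| to remain a
    natural number. *)
Definition cycle_rank A := #|A| + ncomponents A.

Lemma cycle_rankU A e : e \notin A -> cycle_rank (e |: A) = cycle_rank A + joined A e.
Proof.
move=> eA; rewrite /cycle_rank cardsU1 eA add1n; case: (boolP (joined A e)) => je.
  by rewrite ncomponents_joined// addn1.
by rewrite addn0 (ncomponents_unjoined je) addSnnS.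
Qed.

Lemma cycle_rank0 : cycle_rank finset.set0 = #|vertex G|.
Proof.
have c0 x y : linked_in finset.set0 x y = (x == y).
  apply/connectP/eqP => [[[|z p] /=]|->]; [by []| |by exists [::]].
  by rewrite /adjacent_in => /andP[/exists_inP[f]]; rewrite inE.
rewrite /cycle_rank cards0 add0n; apply: eq_card => x; rewrite !inE.
have /= := connect_root (adjacent_in (finset.set0 : {set edge G})) x.
by rewrite -/(linked_in _ _ _) c0 => /eqP e; rewrite /fingraph.roots -e eqxx.
Qed.

Lemma cycle_rankS A B : A \subset B -> cycle_rank A <= cycle_rank B.
Proof.
move=> AB; apply: (@set_subset_ind (fun C => cycle_rank A <= cycle_rank C) A B) => // C e _ eC.
by rewrite cycle_rankU// => h; rewrite (leq_trans h)// leq_addr.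
Qed.

(** The cycle space of A is trivial. *)
Definition forest A := cycle_rank A == #|vertex G|.

Lemma forest_edge A e : forest A -> e \in A -> forest (A :\ e) && ~~ joined (A :\ e) e.
Proof.
move=> /eqP fA eA; have := cycle_rankU (negbT (finset.setD11 e A)); rewrite finset.setD1K// fA => h.
have := cycle_rankS (finset.sub0set (A :\ e)); rewrite cycle_rank0 /forest; move: h.
by case: joined; rewrite ?addn0 ?addn1 => ->; rewrite ?ltnn ?eqxx.
Qed.

Lemma spanning_forest : exists2 T, forest T & forall e, joined T e.
Proof.
have [T /maxsetP[fT mT] _] := @maxset_exists _ forest finset.set0
  (introT eqP cycle_rank0).
exists T => // e; have [eT|eT] := boolP (e \in T); first exact: joined_mem.
apply: contraNT (eT) => je; rewrite -(mT (e |: T)) ?finset.setU11// ?finset.subsetUr//.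
by rewrite /forest cycle_rankU// (negbTE je) addn0.
Qed.

(** Removing an edge of a forest disconnects its ends, so one may shift the
    potential on the side of one of them. The values stay in the subgroup P,
    here an arbitrary one, later 2 pi Z. *)
Lemma forest_potential (V : zmodType) (P : V -> Prop) A (d : edge G -> V) :
  P 0%R -> (forall s t, P s -> P t -> P (s - t)%R) ->
  forest A -> (forall e, e \in A -> P (d e)) ->
  exists h : vertex G -> V, (forall x, P (h x)) /\
    forall e, e \in A -> (h (ends e).2 - h (ends e).1 = d e)%R.
Proof.
move=> P0 PB; elim: {A}#|A| {-2}A (erefl #|A|) => [|n IH] A cA fA dP.
  exists (fun=> 0%R); split=> // e.
  by move/eqP: cA; rewrite cards_eq0 => /eqP->; rewrite inE.
have /finset.set0Pn[e eA] : A != finset.set0 by rewrite -cards_eq0 cA.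
have /andP[fA' je] := forest_edge fA eA.
have [||h [hP hE]] := IH _ _ fA'; first by apply/eqP; rewrite -eqSS -cA (cardsD1 e A) eA.
  by move=> f; rewrite !inE => /andP[_]; exact: dP.
pose s := (d e - (h (ends e).2 - h (ends e).1))%R.
have Ps : P s by apply: (PB _ _ (dP e eA)); apply: PB.
exists (fun z => h z + if linked_in (A :\ e) (ends e).2 z then s else 0)%R.
split=> [z|f fA1].
  have PD t : P t -> P (h z + t)%R.
    by move=> Pt; rewrite -[t]opprK -(sub0r t); apply: (PB) => //; apply: PB.
  by case: ifP => _; apply: PD.
have [->|fe] := eqVneq f e.
  have -> : linked_in (A :\ e) (ends e).2 (ends e).1 = false.
    by rewrite /linked_in linked_in_sym; exact: negbTE je.
  have -> : linked_in (A :\ e) (ends e).2 (ends e).2 by exact: connect0.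
  by rewrite addr0 addrAC /s addrC subrK.
have fA'1 : f \in A :\ e by rewrite !inE fe.
have -> : linked_in (A :\ e) (ends e).2 (ends f).2 = linked_in (A :\ e) (ends e).2 (ends f).1.
  apply/esym/same_connect_r; [exact: linked_in_sym|exact: joined_mem].
by rewrite opprD addrACA subrr addr0 hE.
Qed.

(** The difference of f and cycle_rank never decreases when edges are added. It
    is at least 1 - |V| at the empty set and at most 1 - |V| at T; and it is
    constant from T on, where each new edge adds one to cycle_rank and at most
    one to f. So it equals 1 - |V| everywhere. *)
Lemma cycle_rank_unique (f : {set edge G} -> nat) T :
  (forall A e, e \notin A -> f A + joined A e <= f (e |: A) <= (f A).+1) ->
  forest T -> (forall e, joined T e) -> f T <= 1 <= f finset.set0 ->
  forall A, f A + #|vertex G| = (cycle_rank A).+1.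
Proof.
move=> fU /eqP fT jT /andP[fT1 f01] A.
have mono B C : B \subset C -> f B + cycle_rank C <= f C + cycle_rank B.
  move=> BC; apply: (@set_subset_ind (fun D => f B + cycle_rank D <= f D + cycle_rank B) B C) => // D e _ eD.
  by rewrite cycle_rankU//; have /andP[+ _] := fU D e eD; lia.
have fE : f [set: edge G]%SET + cycle_rank T <= f T + cycle_rank [set: edge G]%SET.
  apply: (@set_subset_ind (fun D => f D + cycle_rank T <= f T + cycle_rank D) T) => // D e TD eD.
  rewrite cycle_rankU// (joinedS TD)//.
  by have /andP[_ +] := fU D e eD; lia.
have := mono _ _ (finset.sub0set A); have := mono _ _ (finset.subsetT A).
by rewrite cycle_rank0; lia.
Qed.

End Components.

Section DualEdges.
Variables (G H : graph) (dag : edge G -> edge H).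
Implicit Types (A B : {set edge G}) (e : edge G).

Definition dual_edges A : {set edge H} := [set dag e | e in ~: A]%SET.

Hypothesis dag_bij : bijective dag.

Lemma mem_dual_edges A e : (dag e \in dual_edges A) = (e \notin A).
Proof. by rewrite mem_imset ?finset.inE//; exact: bij_inj. Qed.

Lemma dual_edges_inj : injective dual_edges.
Proof.
move=> A B AB; apply/finset.setP => e; apply/negb_inj.
by rewrite -!mem_dual_edges AB.
Qed.

Lemma dual_edges_bij : bijective dual_edges.
Proof.
have [k dk kd] := dag_bij.
exists (fun B : {set edge H} => [set e | dag e \notin B]%SET) => A.
  by apply/finset.setP => e; rewrite finset.inE mem_dual_edges negbK.
by apply/finset.setP => f; rewrite -(kd f) mem_dual_edges finset.inE negbK.
Qed.

Lemma dual_edges_setU A e : dual_edges (e |: A) = dual_edges A :\ dag e.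
Proof.
have [k dk kd] := dag_bij; apply/finset.setP => f; rewrite -(kd f).
rewrite finset.in_setD1 !mem_dual_edges finset.in_setU1 negb_or.
by rewrite (inj_eq (can_inj dk)).
Qed.

Lemma dual_edges_setD A e : dual_edges (A :\ e) = dag e |: dual_edges A.
Proof.
have [k dk kd] := dag_bij; apply/finset.setP => f; rewrite -(kd f).
rewrite finset.in_setU1 !mem_dual_edges finset.in_setD1 negb_and negbK.
by rewrite (inj_eq (can_inj dk)).
Qed.

Lemma dual_edges_sym_diff A B e :
  (sym_diff (dual_edges A) (dual_edges B) \subset [set dag e]%SET) =
  (sym_diff A B \subset [set e]%SET).
Proof.
have [k dk kd] := dag_bij; have di := can_inj dk.
apply/fintype.subsetP/fintype.subsetP => h f.
  move=> fAB; have := h (dag f); rewrite !finset.inE !mem_dual_edges !negbK (inj_eq di).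
  by apply; move: fAB; rewrite /sym_diff !finset.inE; case: (f \in A); case: (f \in B).
rewrite -(kd f) => fAB; have := h (k f); rewrite !finset.inE (inj_eq di); apply.
move: fAB; rewrite /sym_diff !finset.inE !mem_dual_edges.
by case: (k f \in A); case: (k f \in B).
Qed.

End DualEdges.

(** * The drawing of a graph *)

Section TopologyLemmas.
Variable X : topologicalType.
Implicit Types (B C : set X).

Lemma connected_setU1 B z : connected B -> closure B z -> connected (B `|` [set z]).
Proof.
move=> cB Bz; apply/connectedP => E [E0 EU sE].
have : B `<=` E false `|` E true by rewrite -EU; exact: subsetUl.
have main b : separated (E b) (E (~~ b)) -> B `<=` E b -> B `|` [set z] = E b `|` E (~~ b) -> False.
  move=> [s1 _] BE eU; have [y Ey] := E0 (~~ b).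
  have : (B `|` [set z]) y by rewrite eU; right.
  case=> [/BE Eby|yz].
    have : (closure (E b) `&` E (~~ b)) y by split; first exact: subset_closure.
    by rewrite s1.
  rewrite yz in Ey; have : (closure (E b) `&` E (~~ b)) z.
    by split => //; exact: closureS BE _ Bz.
  by rewrite s1.
move=> /(connected_subset sE)/(_ cB)[BE|BE]; first exact: (main false).
apply: (main true) => //; first by rewrite separatedC.
by rewrite EU setUC.
Qed.

Lemma closed_finite_union (I : finType) (D : set I) (F : I -> set X) :
  (forall i, D i -> closed (F i)) -> closed (\bigcup_(i in D) F i).
Proof. by move=> cF; apply: closed_bigcup => //; exact: finite_finset. Qed.

End TopologyLemmas.

Section Embedding.
Variables (R : realType) (G : graph) (Gamma : sphere_embedding R G).
Implicit Types (A T : {set edge G}) (e : edge G) (v : vertex G).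
Local Notation vp := (vpoint Gamma).
Local Notation ec := (ecurve Gamma).
Local Notation S2 := (@sphere2 R).

(** The vertices isolated in A belong to the drawing of A. *)
Definition drawing_of A : set 'rV[R]_3 :=
  range vp `|` \bigcup_(e in [set` A]) (ec e @` `[0, 1]).

Lemma itvccE (s : R) : `[0, 1]%classic s = (0 <= s <= 1) :> Prop.
Proof. by rewrite /= in_itv. Qed.

Lemma itvooE (s : R) : `]0, 1[%classic s = (0 < s < 1) :> Prop.
Proof. by rewrite /= in_itv. Qed.

Lemma curve_cases e s : 0 <= s <= 1 ->
  (exists v, ec e s = vp v) \/ 0 < s < 1.
Proof.
move=> /andP[s0 s1].
have [->|s0'] := eqVneq s 0; first by left; exists (ends e).1; rewrite ecurve_start.
have [->|s1'] := eqVneq s 1; first by left; exists (ends e).2; rewrite ecurve_end.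
by right; rewrite !lt_neqAle eq_sym s0' s0 s1' s1.
Qed.

Lemma drawing_ofP A z : drawing_of A z <-> (exists v, z = vp v) \/
  exists e s, [/\ e \in A, 0 < s < 1 & z = ec e s].
Proof.
split=> [[[v _ <-]|[e /= eA [s]]]|[[v ->]|[e [s [eA s01 ->]]]]].
- by left; exists v.
- rewrite /= in_itv/= => /(curve_cases e)[[v h] <-|s01 <-].
    by left; exists v.
  by right; exists e, s.
- by left; exists v.
- right; exists e => //; exists s => //; rewrite /= in_itv/=.
  by case/andP: s01 => /ltW -> /ltW ->.
Qed.

Lemma vpoint_drawing A v : drawing_of A (vp v).
Proof. by left; exists v. Qed.

Lemma ecurve_drawing A e s : e \in A -> 0 <= s <= 1 -> drawing_of A (ec e s).
Proof. by move=> eA s01; right; exists e => //; exists s; rewrite ?itvccE. Qed.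

Lemma drawing_of_sphere A : drawing_of A `<=` S2.
Proof.
move=> z [[v _ <-]|[e _ [s s01 <-]]]; first exact: vpoint_sphere.
exact: ecurve_sphere.
Qed.

Lemma drawing_ofS A T : A \subset T -> drawing_of A `<=` drawing_of T.
Proof.
move=> AT z /drawing_ofP[h|[e [s [eA s01 ->]]]]; apply/drawing_ofP; first by left.
by right; exists e, s; split => //; exact: (fintype.subsetP AT).
Qed.

Lemma drawingE : drawing Gamma = drawing_of [set: edge G]%SET.
Proof.
apply/seteqP; split=> z [[v _ <-]|[e _ h]]; try by left; exists v.
  by right; exists e => //=; rewrite finset.in_setT.
by right; exists e.
Qed.

Lemma drawing_of_drawing A : drawing_of A `<=` drawing Gamma.
Proof. by rewrite drawingE; apply: drawing_ofS; exact: finset.subsetT. Qed.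

Lemma ecurve_not_drawing A e s : e \notin A -> 0 < s < 1 -> ~ drawing_of A (ec e s).
Proof.
rewrite -itvooE => eA s01 /drawing_ofP[[v]|[f [t [fA]]]]; first exact: ecurve_vpoint.
rewrite -itvooE => t01 h; have [ef _] := ecurve_inj s01 t01 h.
by move: eA; rewrite ef fA.
Qed.

Lemma compact_ecurve e (C : set R) : closed C -> compact (ec e @` (`[0, 1] `&` C)).
Proof.
move=> cC; apply: continuous_compact; last first.
  by apply: compact_closedI => //; exact: segment_compact.
apply: continuous_subspaceW (@ecurve_continuous _ _ Gamma e); exact: subIsetl.
Qed.

Lemma closed_ecurve e (C : set R) : closed C -> closed (ec e @` (`[0, 1] `&` C)).
Proof. move=> cC; have := @compact_ecurve e C cC; exact: (compact_closed (@norm_hausdorff R 'rV[R]_3)). Qed.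

Lemma closed_sphere : closed S2.
Proof.
rewrite (_ : S2 = (fun x : 'rV[R]_3 => \sum_(i < 3) x 0 i ^+ 2) @^-1` [set 1])//.
apply: preimage_closed; last exact: closed_eq.
move=> x _; have : continuous (fun x : 'rV[R]_3 => \sum_(i < 3) x 0 i ^+ 2); last exact.
by apply: cts_sum => i; apply: ctsX; exact: coord_continuous.
Qed.

Lemma compact_sphere : compact S2.
Proof.
apply: bounded_closed_compact closed_sphere.
exists 1; split => // M M1 x; rewrite /sphere2/= => x1.
apply: (le_trans _ (ltW M1)); rewrite /Num.norm/= mx_normrE.
apply/bigmax_leP; split=> // -[i j] _ /=; rewrite ord1.
rewrite -(@ler_pXn2r _ 2)// ?nnegrE//.
rewrite expr1n real_normK ?num_real// -x1 (bigD1 j)//= lerDl.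
by apply: sumr_ge0 => k _; exact: sqr_ge0.
Qed.

Lemma closed_point (z : 'rV[R]_3) : closed [set z].
Proof. by apply: accessible_closed_set1; apply: hausdorff_accessible; exact: norm_hausdorff. Qed.

Lemma closed_drawing_of A : closed (drawing_of A).
Proof.
apply: closedU.
  rewrite (_ : range vp = \bigcup_(v in setT) [set vp v]).
    by apply: closed_finite_union => v _; exact: closed_point.
  by apply/seteqP; split=> z [v _]; [move=> <-|move=> ->]; exists v.
apply: closed_finite_union => e _; rewrite -[`[0, 1]%classic]setIT.
by apply: closed_ecurve; exact: closedT.
Qed.

Lemma compact_drawing_of A : compact (drawing_of A).
Proof.
apply: subclosed_compact (@drawing_of_sphere A); last exact: compact_sphere.
exact: closed_drawing_of.
Qed.

Lemma cts_ecurve_clamp e : continuous (fun s => ec e (clamp 1 s)).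
Proof.
apply: (cts_within_comp (@cts_clamp R 1) (@ecurve_continuous _ _ Gamma e)) => s.
by rewrite itvccE /clamp le_min ge_min le_max !lexx !orbT ler01.
Qed.

Lemma clamp_id (s : R) : 0 <= s <= 1 -> clamp 1 s = s.
Proof. by case/andP => s0 s1; rewrite /clamp max_l// min_l. Qed.

Lemma clamp01 (s : R) : 0 <= clamp 1 s <= 1.
Proof. by rewrite /clamp le_min ge_min le_max !lexx !orbT ler01. Qed.

(** Lift along each edge; the lifts fit together at the vertices after adding a
    potential with values in 2 pi Z, because a forest has no cycles. *)
Lemma forest_args_lift T : forest T -> args_lift (drawing_of T).
Proof.
move=> fT f g cf cg fg0.
have /choice[th0 th0P] v : exists t, has_arg (f (vp v)) (g (vp v)) t.
  exact/has_arg_exists/fg0/vpoint_drawing.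
have in0 : 0 <= (0 : R) <= 1 by rewrite lexx ler01.
have in1 : 0 <= (1 : R) <= 1 by rewrite lexx ler01.
have /choice[l lP] e : exists a : R -> R, e \in T -> [/\ continuous a,
    a 0 = th0 (ends e).1 & forall s, 0 <= s <= 1 -> has_arg (f (ec e s)) (g (ec e s)) (a s)].
  have [eT|_] := boolP (e \in T); last by exists id.
  have [||s s01||a [ca a0 aP]] := @path_arg R (fun s => f (ec e (clamp 1 s)))
      (fun s => g (ec e (clamp 1 s))) (th0 (ends e).1).
  - exact: cts_comp (@cts_ecurve_clamp e) cf.
  - exact: cts_comp (@cts_ecurve_clamp e) cg.
  - by apply: fg0; apply: ecurve_drawing => //; exact: clamp01.
  - by rewrite clamp_id// ecurve_start.
  - by exists a => _; split => // s s01; have := aP s s01; rewrite clamp_id.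
have [|||h [hP hE]] := @forest_potential G R (fun t => cos t = 1) T
    (fun e => l e 1 - th0 (ends e).2) _ _ fT.
- exact: cos0.
- exact: cos_eq1_sub.
- move=> e /lP[_ _ le]; apply: (has_arg_uniq (le 1 in1)).
  by rewrite ecurve_end; exact: th0P.
pose a e s := l e s + h (ends e).1.
pose b v := th0 v + h v.
have a0 e : e \in T -> a e 0 = b (ends e).1 by move=> /lP[_ l0 _]; rewrite /a l0.
have a1 e : e \in T -> a e 1 = b (ends e).2.
  by move=> /hE; rewrite /a /b; lra.
have turn t u : cos u = 1 -> forall x y : R, has_arg x y t -> has_arg x y (t + u).
  by move=> u1 x y; move/has_arg_turn; apply; rewrite addrAC subrr add0r.
(* The graph of the union of the lifts b at the vertices and a along the
   edges. *)
pose rel z r := (exists v, z = vp v /\ r = b v) \/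
  exists e s, [/\ e \in T, 0 < s < 1, z = ec e s & r = a e s].
have relE e s : e \in T -> 0 <= s <= 1 -> rel (ec e s) (a e s).
  move=> eT /andP[s0 s1].
  have [->|s0'] := eqVneq s 0.
    by left; exists (ends e).1; rewrite ecurve_start a0.
  have [->|s1'] := eqVneq s 1.
    by left; exists (ends e).2; rewrite ecurve_end a1.
  by right; exists e, s; rewrite !lt_neqAle eq_sym s0' s0 s1' s1.
have rel_fun z r r' : rel z r -> rel z r' -> r = r'.
  move=> [[v [-> ->]]|[e [s [eT s01 -> ->]]]] [[w [e1 ->]]|[e' [s' [eT' s01' e1 ->]]]].
  - by rewrite (vpoint_inj e1).
  - by case: (@ecurve_vpoint _ _ Gamma e' s' v); rewrite ?itvooE.
  - by case: (@ecurve_vpoint _ _ Gamma e s w); rewrite ?itvooE.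
  - by rewrite -itvooE in s01; rewrite -itvooE in s01'; have [<- <-] := ecurve_inj s01 s01' e1.
have /choice[th thP] z : exists r, drawing_of T z -> rel z r.
  have [/drawing_ofP Kz|nKz] := pselect (drawing_of T z); last by exists 0.
  case: Kz => [[v ->]|[e [s [eT s01 ->]]]].
    by exists (b v) => _; left; exists v.
  by exists (a e s) => _; right; exists e, s.
have ca e : e \in T -> continuous (a e).
  by move=> /lP[cl _ _]; rewrite /a; cts.
exists th; split; last first.
  move=> z /thP[[v [-> ->]]|[e [s [eT s01 -> ->]]]]; apply: turn => //.
  have [_ _] := lP e eT; apply; case/andP: s01 => /ltW -> /ltW //.
(* The preimage of a closed set is a finite union of compact sets, the images of
   closed subsets of [0, 1] under the curves. *)
apply/continuous_closedP => C cC; apply/closed_subspaceP.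
exists (\bigcup_(v in [set v | C (b v)]) [set vp v] `|`
  \bigcup_(e in [set` T]) (ec e @` (`[0, 1] `&` (a e @^-1` C)))).
  apply: closedU; first by apply: closed_finite_union => v _; exact: closed_point.
  apply: closed_finite_union => e eT; apply: closed_ecurve.
  by apply: preimage_closed => // s _; exact: ca.
apply/seteqP; split=> z.
  case=> -[[v /= Cv ->] Kz|[e /= eT [s [s01 Cs] <-]] Kz]; split=> //=.
    by rewrite /from_subspace (rel_fun _ _ (b v) (thP _ Kz))//; left; exists v.
  by rewrite /from_subspace (rel_fun _ _ (a e s) (thP _ Kz))//; apply: relE; rewrite -?itvccE.
case=> Cz Kz; split => //.
move: (thP _ Kz) Cz; rewrite /from_subspace /preimage/=.
case=> [[v [-> ->]] Cv|[e [s [eT s01 -> ->]] Cs]]; first by left; exists v.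
right; exists e => //; exists s => //; split => //.
by rewrite itvccE; case/andP: s01 => /ltW -> /ltW ->.
Qed.

End Embedding.

(** * Faces, and the dual connectivity of the complement of a forest *)

Section Faces.
Variables (R : realType) (G : graph) (Gamma : sphere_embedding R G).
Variables (H : graph) (D : dual_graph Gamma H).
Implicit Types (A T : {set edge G}) (e : edge G) (u v w : vertex H).
Local Notation ec := (ecurve Gamma).
Local Notation S2 := (@sphere2 R).
Local Notation draw := (drawing Gamma).
Local Notation dual := (dual_edges (dagger D)).

Definition face v : set 'rV[R]_3 := face_of Gamma (dual_point D v).

Lemma face_sub v : face v `<=` S2 `\` draw.
Proof. exact: connected_component_sub. Qed.

Lemma face_point v : face v (dual_point D v).
Proof. exact/connected_component_refl/dual_point_face. Qed.

Lemma face_connected v : connected (face v).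
Proof. exact: component_connected. Qed.

Lemma face_cover z : (S2 `\` draw) z -> exists v, face v z.
Proof.
move=> Sz; have [|v [zv _]] := @dual_point_unique _ _ _ _ D (face_of Gamma z).
  by exists z.
by exists v; exact: connected_component_sym.
Qed.

Lemma face_inj v w z : face v z -> face w z -> v = w.
Proof.
move=> vz wz; have [|x [_ xu]] := @dual_point_unique _ _ _ _ D (face_of Gamma z).
  by exists z => //; exact: face_sub vz.
by rewrite -(xu v) ?(xu w)//; exact: connected_component_sym.
Qed.

Lemma closure_face_sphere v : closure (face v) `<=` S2.
Proof.
rewrite [X in _ `<=` X](closure_id _).1; last exact: closed_sphere.
by apply: closureS => z /face_sub[].
Qed.

(** Faces are relatively closed in the complement of the drawing. As they are
    finite in number, this takes the place of local connectedness of the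
    sphere. *)
Lemma closure_face v z : closure (face v) z -> ~ draw z -> face v z.
Proof.
move=> cz dz; have Sz := closure_face_sphere cz.
have sub : face v `|` [set z] `<=` S2 `\` draw.
  by move=> y [/face_sub//|->]; split.
apply: (@connected_component_max _ _ _ (dual_point D v) _ sub); last by right.
  by left; exact: face_point.
exact: connected_setU1 (@face_connected v) cz.
Qed.

Lemma side_end v e t : 0 < t < 1 -> closure (face v) (ec e t) ->
  v = (ends (dagger D e)).1 \/ v = (ends (dagger D e)).2.
Proof. by move=> t01 ct; apply/(dagger_ends D); exists t; rewrite ?itvooE. Qed.

Lemma end_side v e : v = (ends (dagger D e)).1 \/ v = (ends (dagger D e)).2 ->
  exists2 t, 0 < t < 1 & closure (face v) (ec e t).
Proof. by move/(dagger_ends D) => [t]; rewrite itvooE; exists t. Qed.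

Section Region.
Variables (T : {set edge G}) (k : pred (vertex H)).
Hypothesis kT : forall e, e \notin T ->
  k (ends (dagger D e)).1 = k (ends (dagger D e)).2.

Definition region : set 'rV[R]_3 := [set z | (exists2 v, k v & face v z) \/
  exists e s, [/\ e \notin T, 0 < s < 1, k (ends (dagger D e)).1 & z = ec e s]].

Lemma region_drawing z : region z -> ~ drawing_of Gamma T z.
Proof.
move=> [[v kv /face_sub[_ nd]] dz|[e [s [eT s01 ke ->]]]].
  exact: nd (drawing_of_drawing dz).
exact: ecurve_not_drawing.
Qed.

(** A boundary point of a face of the region that is not in the drawing of T
    lies on an edge with that face on one side; the other side then belongs to
    the region as well. *)
Lemma closed_region : closed (region `|` drawing_of Gamma T).
Proof.
rewrite (_ : _ `|` _ = (\bigcup_(v in [set v | k v]) closure (face v)) `|`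
    (\bigcup_(e in [set e | e \notin T /\ k (ends (dagger D e)).1]) (ec e @` (`[0, 1] `&` setT)))
    `|` drawing_of Gamma T).
  apply: closedU; last exact: closed_drawing_of.
  apply: closedU; apply: closed_finite_union => x _; first exact: closed_closure.
  exact/closed_ecurve/closedT.
apply/seteqP; split=> z.
  case=> [[[v kv vz]|[e [s [eT s01 ke ->]]]]|]; last by right.
    by left; left; exists v => //; exact: subset_closure.
  left; right; exists e => //; exists s => //; split=> //.
  by rewrite itvccE; case/andP: s01 => /ltW -> /ltW ->.
case=> [[[v kv cz]|[e /= [eT ke] [s [+ _] <-]]]|]; last by right.
- have [/drawing_ofP h|nd] := pselect (drawing_of Gamma [set: edge G]%SET z); last first.
    by left; left; exists v => //; apply: closure_face; rewrite ?drawingE.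
  case: h cz => [[x ->] _|[e [s [_ s01 ->]]] cz]; first by right; exact: vpoint_drawing.
  have [eT|eT] := boolP (e \in T).
    by right; apply: ecurve_drawing => //; case/andP: s01 => /ltW -> /ltW ->.
  left; right; exists e, s; split => //.
  by have [<-|vE] := side_end s01 cz => //; rewrite kT// -vE.
- rewrite /= in_itv/= => /(curve_cases Gamma e)[[x ->]|s01]; first by right; exact: vpoint_drawing.
  by left; right; exists e, s.
Qed.

End Region.

(** Otherwise the faces linked to v in the dual and the remaining faces give two
    regions that separate the sphere off the drawing of T. *)
Lemma forest_dual_connected T : forest T ->
  forall v w, linked_in (dual T) v w.
Proof.
move=> fT v w; apply/negPn/negP => nvw.
pose k : pred (vertex H) := linked_in (dual T) v.
have kT e : e \notin T -> k (ends (dagger D e)).1 = k (ends (dagger D e)).2.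
  move=> eT; apply: same_connect_r; first exact: linked_in_sym.
  by apply: joined_mem; rewrite (mem_dual_edges (dagger_bij D)).
pose k' : pred (vertex H) := [pred x | ~~ k x].
have kT' e : e \notin T -> k' (ends (dagger D e)).1 = k' (ends (dagger D e)).2.
  by move=> eT; rewrite /k' /= kT.
apply: (@not_separated R (drawing_of Gamma T) (region T k) (region T k')
  (dual_point D v) (dual_point D w)).
- exact: compact_drawing_of.
- exact: forest_args_lift.
- apply/seteqP; split=> z.
    case=> [[/drawing_of_sphere//|]|];
      by move=> [[x _ /face_sub[]]|[e [s [_ /andP[/ltW s0 /ltW s1] _ ->]]]]//;
      apply: ecurve_sphere; rewrite itvccE s0 s1.
  move=> Sz; have [/drawing_ofP h|nd] := pselect (drawing_of Gamma [set: edge G]%SET z).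
    case: h => [[x ->]|[e [s [_ s01 ->]]]]; first by left; left; exact: vpoint_drawing.
    have [eT|eT] := boolP (e \in T).
      left; left; apply: ecurve_drawing => //; case/andP: s01 => /ltW -> /ltW ->//.
    by have [ke|ke] := boolP (k (ends (dagger D e)).1);
      [left; right|right]; right; exists e, s.
  have [|x xz] := @face_cover z; first by split=> //; rewrite drawingE.
  by have [kx|kx] := boolP (k x); [left; right|right]; left; exists x.
- by move=> z; exact: region_drawing.
- move=> z [[x kx xz]|[e [s [eT s01 ke ->]]]] [[y ky yz]|[f [t [fT' t01 kf E]]]].
  + by move: ky; rewrite /k' /= -(face_inj xz yz) kx.
  + have [_] := face_sub xz; rewrite drawingE E; apply.
    by apply: ecurve_drawing; rewrite ?finset.in_setT//; case/andP: t01 => /ltW -> /ltW ->.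
  + have [_] := face_sub yz; rewrite drawingE; apply.
    by apply: ecurve_drawing; rewrite ?finset.in_setT//; case/andP: s01 => /ltW -> /ltW ->.
  + rewrite -itvooE in s01; rewrite -itvooE in t01.
    by have [ef _] := ecurve_inj s01 t01 E; move: kf; rewrite /k' /= -ef ke.
- exact: closed_region.
- exact: closed_region.
- by left; exists v; [exact: connect0|exact: face_point].
- by left; exists w; [|exact: face_point].
- by move/drawing_of_drawing; have [] := dual_point_face D w.
Qed.

End Faces.

(** * Cycles separate the two sides of their edges *)

Section Jordan.
Variables (R : realType) (G : graph) (Gamma : sphere_embedding R G).
Variables (H : graph) (D : dual_graph Gamma H).
Implicit Types (A T : {set edge G}) (e : edge G) (u v w : vertex H).
Local Notation vp := (vpoint Gamma).
Local Notation ec := (ecurve Gamma).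
Local Notation S2 := (@sphere2 R).
Local Notation draw := (drawing Gamma).
Local Notation dual := (dual_edges (dagger D)).

Section Linked.
Variables (Q : 'M[R]_3) (hQ : Q *m Q^T = 1%:M).
Hypothesis draw_depth : forall z, draw z -> 0 < depth Q z.

Lemma chord_arg_subcurve (U : set 'rV[R]_3) e (a b : R) :
  U `<=` S2 -> 0 <= a <= 1 -> 0 <= b <= 1 ->
  (forall s, 0 <= s <= 1 -> ~ U (ec e (a + s * (b - a)))) ->
  chord_arg Q U (ec e a) (ec e b).
Proof.
move=> US a01 b01 eU; pose gam s := ec e (clamp 1 (a + s * (b - a))).
have ab01 s : 0 <= s <= 1 -> 0 <= a + s * (b - a) <= 1.
  by move=> s01; apply/andP; split; move: s01 a01 b01 => /andP[? ?] /andP[? ?] /andP[? ?]; nra.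
have -> : ec e a = gam 0 by rewrite /gam mul0r addr0 clamp_id.
have -> : ec e b = gam 1 by rewrite /gam mul1r addrC subrK clamp_id.
apply: (chord_arg_curve hQ US) => [|s].
  apply: continuous_subspaceT; rewrite /gam.
  have ca : continuous (fun s : R => a + s * (b - a)) by cts; exact: cts_id.
  exact: (cts_comp ca (@cts_ecurve_clamp _ _ Gamma e)).
rewrite itvccE => s01; rewrite /gam clamp_id; last exact: ab01.
have dr : draw (ec e (a + s * (b - a))).
  by rewrite drawingE; apply: ecurve_drawing; rewrite ?finset.in_setT//; exact: ab01.
split; [|exact: eU|exact: draw_depth].
by move: dr; rewrite drawingE; exact: drawing_of_sphere.
Qed.

Lemma chord_arg_vertices (U : set 'rV[R]_3) A x y :
  U `<=` S2 -> (forall z, drawing_of Gamma A z -> ~ U z) ->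
  linked_in A x y -> chord_arg Q U (vp x) (vp y).
Proof.
move=> US UA; have nU z : ~ U (vp z) by apply/UA/vpoint_drawing.
have hv z : 0 < depth Q (vp z) by apply: draw_depth; left; exists z.
have edge_link e : e \in A -> chord_arg Q U (vp (ends e).1) (vp (ends e).2).
  move=> eA; rewrite -!(ecurve_start Gamma) -!(ecurve_end Gamma).
  apply: chord_arg_subcurve; rewrite ?lexx ?ler01// => s s01.
  by apply/UA/ecurve_drawing; rewrite // subr0 mulr1 add0r.
case/connectP => p; elim: p x => [|z p IH] x /=.
  by move=> _ ->; exact: (chord_arg_refl hQ US (vpoint_sphere _ _)).
case/andP => /exists_inP[e eA xz] pz yE.
apply: (chord_arg_trans hQ US (vpoint_sphere Gamma z) (nU z) (hv z) _ (IH _ pz yE)).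
case/orP: xz => /eqP xz; have := edge_link e eA; rewrite xz//=.
exact: chord_arg_sym.
Qed.

End Linked.

(** Cut the edge e at its third points x and y. The chord of x and y has a
    continuous argument t1 off the middle third of e, and another one, t2, off
    the drawing of A and the two outer thirds of e, which together link x to y.
    The difference of t1 and t2 is constant on any class of faces that are
    linked in the dual without crossing e or an edge of A. If the faces on both
    sides of e belong to one class, then t2, corrected by the constant,
    continues t1 across the middle third, and the chord has a continuous
    argument on the sphere without x and y, which is absurd. *)
Lemma joined_dual_unjoined A e : e \notin A -> joined A e ->
  ~~ joined (dual (e |: A)) (dagger D e).
Proof.
move=> eA jA; apply/negP => jD.
set u := (ends (dagger D e)).1 in jD; set v := (ends (dagger D e)).2 in jD.
have [Su du] := dual_point_face D u; set n := dual_point D u in Su du.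
(* The pole is taken in a face, so that the drawing has a bounded projection. *)
have [Q [hQ nQ]] := rotate_to_pole Su.
have hn : depth Q n = 0 by rewrite /depth /coord nQ mxE !eqxx subrr.
have dS z : draw z -> S2 z by rewrite drawingE; exact: drawing_of_sphere.
have hd z : draw z -> 0 < depth Q z.
  by move=> dz; apply: (depth_gt0 hQ Su hn (dS _ dz)) => zn; apply: du; rewrite -zn.
pose p : R := 1 / 3; pose q : R := 2 / 3.
have p01 : 0 < p < 1 by rewrite /p; lra.
have q01 : 0 < q < 1 by rewrite /q; lra.
have pq : p < q by rewrite /p /q; lra.
have W01 (s : R) : 0 < s < 1 -> 0 <= s <= 1 by case/andP => /ltW -> /ltW ->.
have de s : 0 <= s <= 1 -> draw (ec e s).
  by move=> s01; rewrite drawingE; apply: ecurve_drawing; rewrite // finset.in_setT.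
have einj f s t : 0 < s < 1 -> 0 < t < 1 -> ec f t = ec e s -> f = e /\ t = s.
  by rewrite -!itvooE => s01 t01 h; exact: ecurve_inj t01 s01 h.
pose x := ec e p; pose y := ec e q.
pose A1 := ec e @` (`[0, 1] `&` `[p, q]).
pose A2 := drawing_of Gamma A `|` (ec e @` (`[0, 1] `&` `[0, p]) `|` ec e @` (`[0, 1] `&` `[q, 1])).
have A1E z : A1 z <-> exists2 s, p <= s <= q & z = ec e s.
  split=> [[s [_ +] <-]|[s sp ->]]; first by rewrite /= in_itv; exists s.
  by exists s => //; rewrite /= !in_itv/= sp; split => //; move: sp p01 q01; lra.
have A2E z : A2 z <-> drawing_of Gamma A z \/
    exists2 s, (0 <= s <= p) || (q <= s <= 1) & z = ec e s.
  split=> [[dz|[[s [_ +] <-]|[s [_ +] <-]]]|[dz|[s /orP[sp|sp] ->]]].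
  - by left.
  - by rewrite /= in_itv/= => sp; right; exists s; rewrite ?sp.
  - by rewrite /= in_itv/= => sp; right; exists s; rewrite ?sp ?orbT.
  - by left.
  - by right; left; exists s => //; rewrite /= !in_itv/= sp; split => //; move: sp p01 q01; lra.
  - by right; right; exists s => //; rewrite /= !in_itv/= sp; split => //; move: sp p01 q01; lra.
have cA1 : closed A1 by apply: closed_ecurve; exact: itv_closed.
have cA2 : closed A2.
  apply: closedU; first exact: closed_drawing_of.
  by apply: closedU; apply: closed_ecurve; exact: itv_closed.
have A1d z : A1 z -> draw z.
  by case/A1E => s sp ->; apply: de; move: sp p01 q01; lra.
have A2d z : A2 z -> draw z.
  case/A2E => [|[s sp ->]]; first exact: drawing_of_drawing.
  by apply: de; move: sp p01 q01 => /orP[]; lra.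
have middle s : p < s < q -> ~ A2 (ec e s).
  move=> sp; have s01 : 0 < s < 1 by move: sp p01 q01; lra.
  case/A2E => [|[t tp E]]; first exact: ecurve_not_drawing.
  have t01 : 0 <= t <= 1 by move: tp p01 q01 => /orP[]; lra.
  have [[c cE]|t01'] := curve_cases Gamma e t01.
    by apply: (@ecurve_vpoint _ _ Gamma e s c); rewrite ?itvooE// E.
  by have [_ st] := einj e s t s01 t01' (esym E); move: tp sp; rewrite st => /orP[]; lra.
pose U1 := S2 `\` A1; pose U2 := S2 `\` A2.
have [t1 [ct1 ht1]] : chord_arg Q U1 x y.
  apply: (chord_arg_subcurve hQ hd) => [z []//|||s s01 [_ nA1]]; try exact: W01.
  apply: nA1; apply/A1E; exists (p + s * (q - p)) => //.
  have -> : p + s * (q - p) = (1 + s) / 3 by rewrite /p /q; field.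
  by rewrite /p /q; lra.
have [t2 [ct2 ht2]] : chord_arg Q U2 x y.
  have SU2 : U2 `<=` S2 by move=> z [].
  have nA2 z : A2 z -> ~ U2 z by move=> Az [].
  have U2v c : ~ U2 (vp c) by apply: nA2; left; exact: vpoint_drawing.
  have hv c : 0 < depth Q (vp c) by apply: hd; left; exists c.
  apply: (chord_arg_trans hQ SU2 (vpoint_sphere Gamma (ends e).1)) => //.
    rewrite -ecurve_start; apply: (chord_arg_sym (chord_arg_subcurve hQ hd _ _ _ _)) => //.
    - by rewrite lexx ler01.
    - exact: W01.
    move=> s s01; apply: nA2; apply/A2E; right; exists (0 + s * (p - 0)) => //.
    by rewrite add0r subr0 /p; lra.
  apply: (chord_arg_trans hQ SU2 (vpoint_sphere Gamma (ends e).2)) => //.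
    apply: (chord_arg_vertices hQ hd SU2) jA => z Az; apply: nA2; by left.
  rewrite -ecurve_end; apply: (chord_arg_subcurve hQ hd) => //.
  - by rewrite lexx ler01.
  - exact: W01.
  move=> s s01; apply: nA2; apply/A2E; right; exists (1 + s * (q - 1)) => //.
  have -> : 1 + s * (q - 1) = 1 - s / 3 by rewrite /q; field.
  by apply/orP; right; rewrite /q; lra.
pose U := U1 `&` U2; pose d z := t1 z - t2 z.
have dconst (B : set 'rV[R]_3) a b : connected B -> B `<=` U -> B a -> B b -> d a = d b.
  move=> cB BU; apply: (@lift_diff R _ B (chord_re Q x y) (chord_im Q x y)) => //.
  - by apply: continuous_subspaceW ct1 => z /BU[].
  - by apply: continuous_subspaceW ct2 => z /BU[].
  - by move=> z /BU[Uz _]; exact: ht1.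
  - by move=> z /BU[_ Uz]; exact: ht2.
have faceU w : face D w `<=` U.
  by move=> z /face_sub[Sz nd]; split; split=> //; [move/A1d|move/A2d].
have nearU f s : f \notin e |: A -> 0 < s < 1 -> U (ec f s).
  rewrite finset.in_setU1 negb_or => /andP[fe fA] s01.
  have Sf : S2 (ec f s) by apply: ecurve_sphere; rewrite itvccE W01.
  have nfe t : 0 <= t <= 1 -> ec f s <> ec e t.
    move=> t01 E; have [[c cE]|t01'] := curve_cases Gamma e t01.
      by apply: (@ecurve_vpoint _ _ Gamma f s c); rewrite ?itvooE// E.
    by have [h _] := einj f t s t01' s01 E; move: fe; rewrite h eqxx.
  split; split => //.
    by move=> /A1E[t tp]; apply: nfe; move: tp p01 q01; lra.
  case/A2E => [|[t tp]]; first exact: ecurve_not_drawing.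
  by apply: nfe; move: tp p01 q01 => /orP[]; lra.
(* The difference d is constant along f, and on each face together with its
   boundary points on f. *)
have cross f a b : f \notin e |: A ->
    (a = (ends (dagger D f)).1 \/ a = (ends (dagger D f)).2) ->
    (b = (ends (dagger D f)).1 \/ b = (ends (dagger D f)).2) ->
    d (dual_point D a) = d (dual_point D b).
  move=> fA /end_side[s s01 cs] /end_side[t t01 ct].
  have E a' s' : 0 < s' < 1 -> closure (face D a') (ec f s') ->
      d (dual_point D a') = d (ec f s').
    move=> s01' cs'; apply: (dconst (face D a' `|` [set ec f s'])).
    - exact: connected_setU1 (@face_connected _ _ _ _ D a') cs'.
    - by move=> z [/faceU//|->]; exact: nearU.
    - by left; exact: face_point.
    - by right.
  rewrite (E a s)// (E b t)//; apply: (dconst (ec f @` `]0, 1[)).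
  - apply: connected_continuous_connected.
      by apply/connected_intervalP; exact: interval_is_interval.
    apply: continuous_subspaceW (@ecurve_continuous _ _ Gamma f) => r.
    by rewrite itvooE itvccE; exact: W01.
  - by move=> z [r]; rewrite itvooE => r01 <-; exact: nearU.
  - by exists s; rewrite ?itvooE.
  - by exists t; rewrite ?itvooE.
have dlink a b : linked_in (dual (e |: A)) a b -> d (dual_point D a) = d (dual_point D b).
  case/connectP => r; elim: r a => [|c r IH] a /=; first by move=> _ ->.
  case/andP => /exists_inP[g gD ac] pc bE; rewrite -(IH _ pc bE).
  have [f /finset.setCP fA gE] := imsetP gD.
  rewrite gE in ac; apply: (cross f); first exact/negP.
    by case/orP: ac => /eqP ->; [left|right].
  by case/orP: ac => /eqP ->; [right|left].
pose k := d n.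
have kface w z : w = u \/ w = v -> face D w z -> d z = k.
  move=> wuv wz; have -> : d z = d (dual_point D w).
    by apply: (dconst (face D w)) => //; [exact: face_connected|exact: face_point].
  by case: wuv => ->//; apply/esym/dlink.
have k1 : cos k = 1.
  have [Un1 Un2] : U n by apply: (faceU u); exact: face_point.
  by rewrite /k /d; exact: has_arg_uniq (ht1 n Un1) (ht2 n Un2).
pose L z := if `[< U1 z >] then t1 z else t2 z + k.
apply: (@no_chord_arg R Q hQ x y).
- exact/dS/de/W01.
- exact/dS/de/W01.
- exact/hd/de/W01.
- exact/hd/de/W01.
- by move=> /(einj e _ _ q01 p01)[_ E]; move: pq; rewrite E ltxx.
have A1xy z : (S2 `\` [set x; y]) z -> ~ U1 z -> exists2 s, p < s < q & z = ec e s.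
  move=> [Sz nz] nU; have /A1E[s /andP[ps sq] zE] : A1 z.
    by apply: contrapT => nA; apply: nU.
  exists s => //; rewrite !lt_neqAle ps sq !andbT.
  by apply/andP; split; apply/eqP => E; apply: nz; rewrite zE; [left; rewrite /x E|right; rewrite /y E].
exists L; split; last first.
  move=> z Uz; rewrite /L; case: asboolP => [U1z|nU1]; first exact: ht1.
  have [s sp zE] := A1xy z Uz nU1.
  have U2z : U2 z by split; [case: Uz|rewrite zE; exact: middle].
  by apply: (has_arg_turn (ht2 z U2z)); rewrite addrAC subrr add0r.
apply/subspace_continuousP => z Uz.
have [U1z|nU1] := pselect (U1 z).
  have LE : from_subspace (S2 `\` [set x; y]) L z = t1 z by rewrite /from_subspace /L asboolT.
  rewrite LE => P Pz; have /subspace_continuousP/(_ z U1z _ Pz) := ct1.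
  have nz : nbhs z (~` A1) by apply: open_nbhs_nbhs; split; [exact: closed_openC|case: U1z].
  apply: filterS2 nz => w nA1 h [Sw _].
  have U1w : U1 w by split.
  by rewrite /= /from_subspace /L asboolT//; exact: h.
have [s sp zE] := A1xy z Uz nU1.
have s01 : 0 < s < 1 by move: sp p01 q01; lra.
have U2z : U2 z by split; [case: Uz|rewrite zE; exact: middle].
have LE : from_subspace (S2 `\` [set x; y]) L z = t2 z + k.
  by rewrite /from_subspace /L asboolF.
rewrite LE.
have ct2k : {within U2, continuous (fun z => t2 z + k)}.
  by apply: ctsD => //; exact: cts_cst.
move=> P Pz; have /subspace_continuousP/(_ z U2z _ Pz) := ct2k.
(* Near z there are only points of the middle third of e and of the faces u and
   v, where t1 = t2 + k. *)
have nA2 : nbhs z (~` A2) by apply: open_nbhs_nbhs; split; [exact: closed_openC|case: U2z].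
have nO : nbhs z (~` drawing_of Gamma [set f | f != e]%SET).
  apply: open_nbhs_nbhs; split; first exact/closed_openC/closed_drawing_of.
  by rewrite zE; apply: ecurve_not_drawing; rewrite // finset.inE eqxx.
have nF : nbhs z (~` \bigcup_(w in [set w | w != u /\ w != v]) closure (face D w)).
  apply: open_nbhs_nbhs; split.
    by apply: closed_openC; apply: closed_finite_union => w _; exact: closed_closure.
  move=> [w /= [wu wv]]; rewrite zE => /(side_end s01)[wE|wE].
    by move: wu; rewrite wE eqxx.
  by move: wv; rewrite wE eqxx.
apply: filterS2 (filterI nA2 (filterI nO nF)) => w [nA2w [nOw nFw]] h [Sw _].
have U2w : U2 w by split.
suff E : L w = t2 w + k by rewrite /= /from_subspace E; exact: h.
rewrite /L; case: asboolP => // U1w.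
have nd : ~ draw w.
  rewrite drawingE => /drawing_ofP[[c wE]|[f [r [_ r01 wE]]]].
    by apply: nOw; rewrite wE; exact: vpoint_drawing.
  have [fe|fe] := eqVneq f e; last first.
    by apply: nOw; rewrite wE; apply: ecurve_drawing; rewrite ?W01// finset.inE.
  have [pr|pr] := boolP (p <= r <= q).
    by case: U1w => _; apply; apply/A1E; exists r; rewrite // wE fe.
  apply: nA2w; apply/A2E; right; exists r; last by rewrite wE fe.
  move: pr r01; rewrite negb_and -!ltNge => /orP[/ltW h1|/ltW h1] /andP[/ltW h2 /ltW h3].
    by rewrite h1 h2.
  by rewrite h1 h3 orbT.
have [|c cw] := @face_cover _ _ _ _ D w; first by split.
have cuv : c = u \/ c = v.
  apply: contrapT => /not_orP[cu cv]; apply: nFw; exists c.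
    by split; apply/eqP.
  exact: subset_closure.
by have := kface c w cuv cw; rewrite /d => <-; rewrite addrC subrK.
Qed.

(** Adding e to A removes dagger e from the dual, which creates a component
    unless the ends of dagger e remain joined. The connected dual of a spanning
    forest provides the initial value in cycle_rank_unique. *)
Lemma ncomponents_dual A : (0 < #|edge G|)%N ->
  (ncomponents (dual A) + #|vertex G| = (#|A| + ncomponents A).+1)%N.
Proof.
case/card_gt0P => e0 _.
have [T fT jT] := spanning_forest G.
apply: (@cycle_rank_unique G (fun A => ncomponents (dual A)) T) => // [B e eB|].
  have -> : dual B = dagger D e |: dual (e |: B).
    by rewrite -(dual_edges_setD (dagger_bij D)) finset.setU1K.
  have [jD|jD] := boolP (joined (dual (e |: B)) (dagger D e)).
    rewrite ncomponents_joined// leqnSn andbT.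
    case: (boolP (joined B e)) => [jB|_]; last by rewrite addn0.
    by move: jD; rewrite (negbTE (joined_dual_unjoined eB jB)).
  by rewrite (ncomponents_unjoined jD) leqnn andbT -addn1 leq_add2l leq_b1.
apply/andP; split.
  apply/card_le1P => a; rewrite !finset.inE => /andP[ra _] b; rewrite !finset.inE.
  rewrite andbT; apply/idP/eqP => [rb|->//].
  have /(fingraph.rootP (@linked_in_sym _ _)) := forest_dual_connected D fT a b.
  by rewrite (eqP ra) (eqP rb).
apply/card_gt0P; exists (fingraph.root (adjacent_in (dual finset.set0)) (ends (dagger D e0)).1).
by rewrite !finset.inE andbT; apply: roots_root; exact: linked_in_sym.
Qed.

End Jordan.

(** * Transport of the heat-bath dynamics to the dual *)

Section HeatBath.
Variable R : realType.

(** Eigenvectors are transported along phi, entry by entry; the two matrices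
    have propositionally equal, but not convertible, sizes. *)
Lemma eigenvalue_reindex (I J : finType) (phi : I -> J) (F : fieldType)
    (M : I -> I -> F) (N : J -> J -> F) (a : F) :
  bijective phi -> (forall x y, N (phi x) (phi y) = M x y) ->
  eigenvalue (\matrix_(i < #|I|, j < #|I|) M (enum_val i) (enum_val j)) a ->
  eigenvalue (\matrix_(i < #|J|, j < #|J|) N (enum_val i) (enum_val j)) a.
Proof.
move=> [psi phiK psiK] NM /eigenvalueP[w wM w0].
apply/eigenvalueP; exists (\row_j w 0 (enum_rank (psi (enum_val j)))).
  apply/rowP => j; rewrite !mxE.
  move/rowP/(_ (enum_rank (psi (enum_val j)))): wM; rewrite !mxE => <-.
  rewrite [LHS](reindex (fun i : 'I_#|I| => enum_rank (phi (enum_val i)))) /=; last first.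
    exists (fun i : 'I_#|J| => enum_rank (psi (enum_val i))) => i _.
      by rewrite enum_rankK phiK enum_valK.
    by rewrite enum_rankK psiK enum_valK.
  apply: eq_bigr => i _; rewrite !mxE !enum_rankK phiK enum_valK.
  by rewrite -[in LHS](psiK (enum_val j)) NM.
apply: contraNneq w0 => w0; apply/eqP/rowP => i.
move/rowP/(_ (enum_rank (phi (enum_val i)))): w0.
by rewrite !mxE enum_rankK phiK enum_valK.
Qed.

Lemma spectral_gap_reindex (I J : finType) (phi : I -> J)
    (M : I -> I -> R) (N : J -> J -> R) :
  bijective phi -> (forall x y, N (phi x) (phi y) = M x y) ->
  spectral_gap (\matrix_(i < #|I|, j < #|I|) M (enum_val i) (enum_val j)) =
  spectral_gap (\matrix_(i < #|J|, j < #|J|) N (enum_val i) (enum_val j)).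
Proof.
move=> bphi NM; have [psi phiK psiK] := bphi.
have MN x y : M (psi x) (psi y) = N x y by rewrite -NM !psiK.
have map_mxE (K : finType) (P : K -> K -> R) :
    map_mx (real_complex R) (\matrix_(i < #|K|, j < #|K|) P (enum_val i) (enum_val j)) =
    \matrix_(i < #|K|, j < #|K|) real_complex R (P (enum_val i) (enum_val j)).
  by apply/matrixP => i j; rewrite !mxE.
rewrite /spectral_gap; congr (1 - sup _); congr (image _ _).
apply/funext => xi /=; apply/propext; rewrite !map_mxE.
have bpsi : bijective psi by exists phi.
split=> -[ev xi1]; split=> //.
  refine (@eigenvalue_reindex I J phi _ (fun x y => real_complex R (M x y))
    (fun x y => real_complex R (N x y)) xi bphi _ ev).
  by move=> x y; rewrite NM.
refine (@eigenvalue_reindex J I psi _ (fun x y => real_complex R (N x y))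
    (fun x y => real_complex R (M x y)) xi bpsi _ ev).
by move=> x y; rewrite MN.
Qed.

End HeatBath.

Section Duality.
Variables (R : realType) (G H : graph) (dag : edge G -> edge H).
Variables (p pstar q : R).
Hypotheses (dag_bij : bijective dag) (p_gt0 : 0 < p) (p_lt1 : p < 1) (q_gt0 : 0 < q).
Hypothesis pstarE : pstar / (1 - pstar) = q * (1 - p) / p.
Implicit Types (A B : {set edge G}) (e : edge G).
Local Notation dual := (dual_edges dag).
Hypothesis euler : forall A,
  (ncomponents (dual A) + #|vertex G| = (#|A| + ncomponents A).+1)%N.

(** Up to constants, ((1 - p) q / p)^|dual A| is (p / (1 - p))^|A| / q^|A|, and
    q^c(dual A) is q^(|A| + c(A)) by the relation of Euler. *)
Lemma rc_weight_dual : exists2 c : R, 0 < c &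
  forall A, rc_weight pstar q (dual A) = c * rc_weight p q A.
Proof.
exists ((q * (1 - p) / p) ^+ #|edge G| * q / q ^+ #|vertex G|).
  rewrite divr_gt0 ?exprn_gt0// mulr_gt0// exprn_gt0// divr_gt0// mulr_gt0//.
  by rewrite subr_gt0.
move=> A; rewrite /rc_weight pstarE.
have p0 : p != 0 by rewrite gt_eqF.
have p1 : 1 - p != 0 by rewrite gt_eqF// subr_gt0.
have q0 : q != 0 by rewrite gt_eqF.
have cE : #|edge G| = (#|A| + #|dual A|)%N.
  by rewrite card_imset ?cardsC//; exact: bij_inj.
have vE : q ^+ ncomponents (dual A) = q ^+ #|A| * q ^+ ncomponents A * q / q ^+ #|vertex G|.
  apply: (mulIf (expf_neq0 #|vertex G| q0)).
  by rewrite divfK ?expf_neq0// -[LHS]exprD euler exprSr exprD.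
have aE : (q * (1 - p) / p) ^+ #|A| * (p / (1 - p)) ^+ #|A| = q ^+ #|A|.
  by rewrite -exprMn; congr (_ ^+ _); field; rewrite p0 p1.
by rewrite vE cE exprD -aE; ring.
Qed.

Lemma rc_measure_dual A : rc_measure pstar q (dual A) = rc_measure p q A.
Proof.
have [c c0 cE] := rc_weight_dual.
have ZE : rc_Z H pstar q = c * rc_Z G p q.
  rewrite /rc_Z (reindex dual) /=; last exact/onW_bij/dual_edges_bij.
  by rewrite mulr_sumr; apply: eq_bigr => B _; exact: cE.
by rewrite /rc_measure cE ZE -mulf_div divff ?mul1r// gt_eqF.
Qed.

(** Inserting e in A means deleting its dual edge from dual A, so the two terms
    of the denominator are exchanged. *)
Lemma heat_bath_offdiag_dual A B :
  heat_bath_offdiag pstar q (dual A) (dual B) = heat_bath_offdiag p q A B.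
Proof.
rewrite /heat_bath_offdiag (bij_eq_card dag_bij); congr (_ * _).
rewrite (reindex dag) /=; last exact: onW_bij.
apply: eq_bigr => e _; rewrite (dual_edges_sym_diff dag_bij).
by rewrite -(dual_edges_setU dag_bij) -(dual_edges_setD dag_bij) !rc_measure_dual [X in _ / X]addrC.
Qed.

Lemma heat_bath_dual A B :
  heat_bath pstar q (dual A) (dual B) = heat_bath p q A B.
Proof.
rewrite /heat_bath (inj_eq (dual_edges_inj dag_bij)) heat_bath_offdiag_dual.
case: eqP => // _; congr (1 - _).
rewrite (reindex dual) /=; last exact/onW_bij/dual_edges_bij.
by apply: eq_big => [C|C _]; rewrite ?(inj_eq (dual_edges_inj dag_bij))// heat_bath_offdiag_dual.
Qed.

End Duality.

Theorem lemma16 (R : realType) (G : graph) (Gamma : sphere_embedding R G)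
    (Gdual : graph) (D : dual_graph Gamma Gdual)
    (p pstar : R) (q : nat)
    (E_nonempty : (0 < #|edge G|)%N)
    (p_gt0 : 0 < p) (p_lt1 : p < 1)
    (q_ge1 : (1 <= q)%N)
    (pstar_gt0 : 0 < pstar) (pstar_lt1 : pstar < 1)
    (pstarE : pstar / (1 - pstar) = q%:R * (1 - p) / p) :
  spectral_gap (heat_bath_mx G p q%:R) =
  spectral_gap (heat_bath_mx Gdual pstar q%:R).
Proof.
have q_gt0 : 0 < q%:R :> R by rewrite ltr0n.
apply: (spectral_gap_reindex (dual_edges_bij (dagger_bij D))) => A B.
apply: (heat_bath_dual (dagger_bij D) p_gt0 p_lt1 q_gt0 pstarE) => C.
exact: ncomponents_dual.
Qed.
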